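(* Let $n\ge 1$, $m\ge 1$, let $a_I$ ($1\le|I|\le m$) be polynomials in $\mathbf{C}^n$, and for an entire function $f$ in $\mathbf{C}^n$ let $$Df=\sum_{|I|=1}^{m} a_I\,\frac{\partial^{|I|}f}{\partial z_1^{i_1}\cdots\partial z_n^{i_n}}.$$ Suppose that $f$ is an entire function in $\mathbf{C}^n$. If $f$ omits $0$ and $Df$ omits $1$, then $Df$ is identically zero.
   Context: Here $I=(i_1,\dots,i_n)$ is a multi-index with nonnegative integer entries, $|I|=i_1+\cdots+i_n$, and the sum runs over all multi-indices with $1\le|I|\le m$. An entire function in $\mathbf{C}^n$ is a function $\mathbf{C}^n\to\mathbf{C}$ holomorphic on all of $\mathbf{C}^n$. A function omits a value $w\in\mathbf{C}$ if it does not take the value $w$ at any point of $\mathbf{C}^n$. *)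

(* Defs.v *)
From HB Require Import structures.
From mathcomp Require Import all_boot all_order all_algebra.
From mathcomp Require Import all_classical all_reals all_analysis.
From mathcomp Require Import complex.
(* The notations of mpoly clash with those of mathcomp-analysis. *)
From mathcomp Require Import -(notations) mpoly.

Set Implicit Arguments.
Unset Strict Implicit.
Unset Printing Implicit Defensive.
Import Order.TTheory GRing.Theory Num.Theory.
Import numFieldNormedType.Exports.

Local Open Scope ring_scope.
Local Open Scope classical_set_scope.

(* [R[i]] with the topology and the normed-module structure over itself given by
   the complex modulus; 'rV[R[i]]_n is then C^n with the sup norm, and
   [differentiable], ['D_v] below are complex differentiability and complex
   directional derivatives. *)
HB.instance Definition _ (R : realType) := NormedModule.copy R[i] R[i]^o.

Definition entire (R : realType) (n : nat) (f : 'rV[R[i]]_n -> R[i]) : Prop :=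
  forall z, differentiable f z.

Definition omits (T U : Type) (f : T -> U) (w : U) : Prop :=
  forall z, f z <> w.

Definition partial (R : realType) (n : nat) (j : 'I_n)
    (f : 'rV[R[i]]_n -> R[i]) : 'rV[R[i]]_n -> R[i] :=
  'D_(delta_mx 0 j) f.

(* d_1^{i_1} (d_2^{i_2} (... (d_n^{i_n} f))) *)
Definition multi_partial (R : realType) (n : nat) (I : multinom n)
    (f : 'rV[R[i]]_n -> R[i]) : 'rV[R[i]]_n -> R[i] :=
  foldr (fun j => iter (I j) (partial j)) f (enum 'I_n).

(* [bmultinom n m.+1] is the finite type of multi-indices of degree at most [m];
   only the coefficients [a I] with [1 <= |I| <= m] are used. *)
Definition diffop (R : realType) (n m : nat)
    (a : multinom n -> mpoly n R[i])
    (f : 'rV[R[i]]_n -> R[i]) (z : 'rV[R[i]]_n) : R[i] :=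
  \sum_(I : bmultinom n m.+1 | (1 <= mdeg I)%N)
    meval (fun j => z 0 j) (a I) * multi_partial I f z.

(* Main.v *)
Require Import Defs.
From HB Require Import structures.
From mathcomp Require Import all_boot all_order all_algebra.
From mathcomp Require Import all_classical all_reals all_analysis.
From mathcomp Require Import complex.
From mathcomp Require Import -(notations) mpoly.
From mathcomp Require Import ring lra.
Set Implicit Arguments.
Unset Strict Implicit.
Unset Printing Implicit Defensive.
Import Order.TTheory GRing.Theory Num.Theory.
Import numFieldNormedType.Exports.
Local Open Scope ring_scope.
Local Open Scope classical_set_scope.
Local Open Scope complex_scope.

(** A zero-free entire function [f] is an exponential, so each partial
derivative of [f] is [f] times a function built from the derivatives of the
logarithmic derivatives [df / f]. Hence [D f = P * f], where [P] should be
negligible compared with [f]. The proof makes negligible precise, with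
respect to the growth [m r], the maximum of [ln |f| - ln |f z0|] on the ball
of radius [r] around a base point [z0]: a function is tame if on this ball it
is bounded by a power of [(1 + m s) * s * s / (s - r)], up to a constant, for
all [s > r] with [s >= 1].
This plays the part of the small functions of Nevanlinna theory, with
an explicit price for passing from the radius [s] to [r] in place of an
exceptional set.

Tame holomorphic functions are stable under sums, products and derivatives.
The lemma on the logarithmic derivative ([tame_logder]) says that [d phi / phi]
is tame when [phi] has no zeros and [ln |phi|] is bounded above by a power of
the same quantity. It rests on two estimates for zero-free functions, the
bound for the gradient of [ln |phi|] ([gradient]) and a Harnack inequality
([harnack]). It applies to [f], which makes [P] tame, and to [F - 1] with
[F = D f], since [F] omits 1.

Let [psi = dF / (F - 1)] be the second logarithmic derivative, in a direction
[w]. As [F = P * f], also [dF = P' * f] with [P'] tame, and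
[dF = psi * (F - 1)] turns into [Q * f = psi] with [Q = P * psi - P'].
So [f] is a quotient of tame functions, which is absurd for nonconstant [f]
([tame_quotient]): for suitable radii [r], and near a point [y] of the ball of
radius [r] where [|f|] is maximal, [|f|] is at least [exp (m r / 2)] up to a
constant, so [Q] is tiny there. On the circle through [y] around [z0] in their common complex line, the
product of [N] rotated copies of [Q], with [N] of the order of [s / (s - r)],
is therefore tiny everywhere, and so is its value [Q z0 ^+ N] at the center
([rotation_product]). As [Q z0] is not 0, this bounds [m r] by a
multiple of [s / (s - r)] times the logarithm of the tame scale. A choice of
radii in the manner of Borel ([growth_step]) contradicts the linear growth
of [m] that the gradient estimate yields.

This settles the case in which [dF] is not identically 0: then [f] is constant
and [D f = 0]. If [F] is a constant other than 0, then [P * f = F] is already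
a relation of the same kind.

All the analysis takes place on complex lines. Goursat's theorem for
rectangles gives the mean value property through the exponential map, and from
it Cauchy's formula for the derivative, the regularity of derivatives, and
logarithms of zero-free functions. The functions live on an arbitrary complex
normed module until compactness of closed balls, and at the very end
coordinates, are called for. *)

(** * The norm as a real number *)

Section Modulus.
Context {R : realType}.

(** The norm of a complex normed module takes its values in [R[i]]; as an
    element of [R] it can enter real inequalities. *)
Definition nrm {V : normedModType R[i]} (v : V) : R := complex.Re `|v|.

Section Generic.
Context {V : normedModType R[i]}.
Implicit Types v w : V.

Lemma nrmE v : `|v| = (nrm v)%:C.
Proof. by rewrite /nrm RRe_real ?normr_real. Qed.

Lemma nrm_ge0 v : 0 <= nrm v.
Proof. by rewrite -lecR -nrmE; exact: normr_ge0. Qed.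

Lemma nrm0 : nrm (0 : V) = 0.
Proof. by rewrite /nrm normr0. Qed.

Lemma nrm_eq0 v : nrm v = 0 -> v = 0.
Proof. by move=> h; apply/eqP; rewrite -normr_eq0 nrmE h. Qed.

Lemma nrm_gt0 v : v != 0 -> 0 < nrm v.
Proof.
by move=> v0; rewrite lt_def nrm_ge0 andbT; apply: contra v0 => /eqP/nrm_eq0 ->.
Qed.

Lemma nrmN v : nrm (- v) = nrm v.
Proof. by rewrite /nrm normrN. Qed.

Lemma nrmD v w : nrm (v + w) <= nrm v + nrm w.
Proof. by rewrite -lecR rmorphD/= -!nrmE; exact: ler_normD. Qed.

Lemma nrmB v w : nrm (v - w) <= nrm v + nrm w.
Proof. by rewrite (le_trans (nrmD _ _)) ?nrmN. Qed.

Lemma nrm_distC v w : nrm (v - w) = nrm (w - v).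
Proof. by rewrite -nrmN opprB. Qed.

Lemma nrm_sub_ge v w : nrm v - nrm w <= nrm (v - w).
Proof. by rewrite lerBlDr; apply: le_trans (nrmD _ _); rewrite subrK. Qed.

Lemma nrmZ (c : R[i]) v : nrm (c *: v) = nrm c * nrm v.
Proof.
by apply: complexI; rewrite rmorphM/= -!nrmE normrZ.
Qed.

Lemma nrm_nbhs v (P : set V) :
  nbhs v P <-> exists2 d : R, 0 < d & forall w, nrm w < d -> P (v + w).
Proof.
split=> [/nbhs_normP[e /= e0 eP]|[d d0 dP]].
  exists (complex.Re e); first by move: e0; rewrite ltcE/= => /andP[].
  move=> w wd; apply: eP => /=.
  rewrite opprD addrA subrr add0r normrN nrmE.
  by rewrite -(RRe_real (gtr0_real e0)) ltcR.
apply/nbhs_normP; exists d%:C; first by rewrite /= ltcR.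
move=> w /= wd; rewrite -(subrK v w) addrC; apply: dP.
by rewrite -ltcR -nrmE -normrN opprB.
Qed.

End Generic.

Implicit Types z w : R[i].

Lemma nrmcE z : nrm z = Normc.normc z.
Proof. by apply: complexI; rewrite -nrmE. Qed.

Lemma nrmM z w : nrm (z * w) = nrm z * nrm w.
Proof. by rewrite !nrmcE Normc.normcM. Qed.

Lemma nrm1 : nrm (1 : R[i]) = 1.
Proof. by rewrite nrmcE Normc.normc1. Qed.

Lemma nrmV z : nrm z^-1 = (nrm z)^-1.
Proof. by rewrite !nrmcE Normc.normcV. Qed.

Lemma nrmX z n : nrm (z ^+ n) = nrm z ^+ n.
Proof. by elim: n => [|n ih]; rewrite ?expr0 ?nrm1// !exprS nrmM ih. Qed.

Lemma nrm_real (x : R) : nrm (x%:C) = `|x|.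
Proof. by rewrite nrmcE /= expr0n addr0 sqrtr_sqr. Qed.

Lemma nrm_sqr z : nrm z ^+ 2 = complex.Re z ^+ 2 + complex.Im z ^+ 2.
Proof. by case: z => a b; rewrite nrmcE /= sqr_sqrtr// addr_ge0 ?sqr_ge0. Qed.

Lemma Re_le_nrm z : complex.Re z <= nrm z.
Proof.
apply: le_trans (ler_norm _) _; rewrite -ler_sqr ?nnegrE ?nrm_ge0//.
by rewrite nrm_sqr real_normK ?num_real// lerDl sqr_ge0.
Qed.

Lemma absRe_le_nrm z : `|complex.Re z| <= nrm z.
Proof.
rewrite -ler_sqr ?nnegrE ?nrm_ge0//.
by rewrite nrm_sqr real_normK ?num_real// lerDl sqr_ge0.
Qed.

Lemma absIm_le_nrm z : `|complex.Im z| <= nrm z.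
Proof.
rewrite -ler_sqr ?nnegrE ?nrm_ge0//.
by rewrite nrm_sqr real_normK ?num_real// lerDr sqr_ge0.
Qed.

Lemma nrm_le_ReIm z : nrm z <= `|complex.Re z| + `|complex.Im z|.
Proof.
rewrite -ler_sqr ?nnegrE ?nrm_ge0 ?addr_ge0//.
rewrite nrm_sqr sqrrD !real_normK ?num_real// addrAC lerDl.
by rewrite mulrn_wge0 ?mulr_ge0.
Qed.

Lemma nrm_conj z : nrm (z^*) = nrm z.
Proof. by case: z => a b; rewrite !nrmcE /= sqrrN. Qed.

Lemma Re_conjM z : complex.Re (z^* * z) = nrm z ^+ 2.
Proof. by case: z => a b; rewrite nrm_sqr /=; ring. Qed.

End Modulus.

(** * Complex derivatives and derivatives along the real line *)

Section Derivative.
Context {R : realType}.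
Local Notation C := R[i].

Lemma diff_eps {V W : normedModType R[i]} (f : V -> W) z :
  differentiable f z -> forall e : R, 0 < e -> exists2 d : R, 0 < d &
    forall w, nrm w < d -> nrm (f (z + w) - f z - 'd f z w) <= e * nrm w.
Proof.
move=> /diff_locally /eqaddoP fo e e0.
have e0' : 0 < e%:C by rewrite ltcR.
have /nrm_nbhs[d d0 dP] := fo _ e0'.
exists d => // w /dP /=.
rewrite add0r !nrmE /= -rmorphM lecR.
suff -> : (f \o shift z - (cst (f z) + 'd f z)) w = f (z + w) - f z - 'd f z w by [].
by rewrite -[RHS]addrA -opprD [z + w]addrC.
Qed.

Lemma eps_diff {V W : normedModType R[i]} (f : V -> W) z (L : {linear V -> W}) :
  continuous L ->
  (forall e : R, 0 < e -> exists2 d : R, 0 < d &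
    forall w, nrm w < d -> nrm (f (z + w) - f z - L w) <= e * nrm w) ->
  differentiable f z /\ 'd f z = L :> (V -> W).
Proof.
move=> cL fL.
have dE : f \o shift z = cst (f z) + L +o_ (nbhs (0 : V)) id.
  apply/eqaddoP => e e0.
  have eE : e = (complex.Re e)%:C by rewrite RRe_real// gtr0_real.
  have e0' : 0 < complex.Re e by rewrite -ltcR -eE.
  apply/nrm_nbhs; have [d d0 dP] := fL _ e0'; exists d => // w /dP.
  rewrite add0r !nrmE eE -rmorphM lecR.
  suff -> : (f \o shift z - (cst (f z) + L)) w = f (z + w) - f z - L w by [].
  by rewrite -[RHS]addrA -opprD [z + w]addrC.
have dL := diff_unique cL dE.
by split=> //; apply/diff_locallyP; rewrite dL.
Qed.

Lemma eps_continuous {V W : normedModType R[i]} (f : V -> W) z :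
  (forall e : R, 0 < e -> exists2 d : R, 0 < d &
    forall w, nrm w < d -> nrm (f (z + w) - f z) <= e) -> {for z, continuous f}.
Proof.
move=> fP; apply/(@cvgrPdist_le _ _ _ (nbhs z)) => e e0.
have eE : e = (complex.Re e)%:C by rewrite RRe_real// gtr0_real.
have e0' : 0 < complex.Re e by rewrite -ltcR -eE.
apply/nrm_nbhs; have [d d0 dP] := fP _ e0'; exists d => // w /dP.
by rewrite nrmE eE lecR nrm_distC.
Qed.

Lemma continuous_eps {V W : normedModType R[i]} (f : V -> W) z :
  {for z, continuous f} -> forall e : R, 0 < e -> exists2 d : R, 0 < d &
    forall w, nrm w < d -> nrm (f (z + w) - f z) <= e.
Proof.
move=> fz e e0; have e0' : 0 < e%:C by rewrite ltcR.
have /(@cvgrPdist_le _ _ _ (nbhs z)) /(_ _ e0') /nrm_nbhs[d d0 dP] := fz.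
by exists d => // w /dP; rewrite nrmE lecR nrm_distC.
Qed.

(** The derivative of a function of one complex variable as a number rather
    than as a linear map. *)
Definition has_der (h : C -> C) (z c : C) := forall e : R, 0 < e ->
  exists2 d : R, 0 < d &
  forall w, nrm w < d -> nrm (h (z + w) - h z - c * w) <= e * nrm w.

Lemma has_der_diff h z c : has_der h z c ->
  differentiable h z /\ 'd h z = (fun w => c * w) :> (C -> C).
Proof.
move=> hc.
have lin : linear (fun w : C => c * w).
  by move=> a u v; rewrite mulrDr -[a *: u]/(a * u) mulrCA.
pose L' := GRing.isLinear.Build _ _ _ _ (fun w : C => c * w) lin.
pose L : {linear C -> C} := HB.pack (fun w : C => c * w) L'.
by apply: (@eps_diff _ _ h z L) => // w; exact: mulrl_continuous.
Qed.

Lemma diff_has_der h z : differentiable h z -> has_der h z ('d h z 1).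
Proof.
move=> dh e e0; have [d d0 dP] := diff_eps dh e0; exists d => // w /dP.
by rewrite -{2}[w]mulr1 -[w * 1]/(w *: 1) linearZ /= -[_ *: _]/(_ * _) [_ * w]mulrC.
Qed.

Lemma has_der_uniq h z c c' : has_der h z c -> has_der h z c' -> c = c'.
Proof.
move=> /has_der_diff[_ h1] /has_der_diff[_]; rewrite h1 => /(congr1 (@^~ 1)).
by rewrite !mulr1.
Qed.

Lemma has_der_line {V : normedModType R[i]} (f : V -> C) (z w : V) t :
  differentiable f (z + t *: w) ->
  has_der (fun s => f (z + s *: w)) t ('d f (z + t *: w) w).
Proof.
move=> df e e0.
have e1 : 0 < e / (nrm w + 1) by rewrite divr_gt0// ltr_wpDl// nrm_ge0.
have [d d0 dP] := diff_eps df e1.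
exists (d / (nrm w + 1)); first by rewrite divr_gt0// ltr_wpDl// nrm_ge0.
move=> s sd.
have n1 : 0 < nrm w + 1 by rewrite ltr_wpDl// nrm_ge0.
have := dP (s *: w); rewrite nrmZ.
have -> : nrm s * nrm w < d.
  move: sd; rewrite ltr_pdivlMr// => sd; apply: le_lt_trans sd.
  by rewrite ler_wpM2l ?nrm_ge0// lerDl.
move=> /(_ isT); rewrite linearZ /= -[_ *: 'd _ _ _]/(_ * _) mulrC.
rewrite scalerDl addrA => /le_trans; apply.
rewrite mulrAC ler_pdivrMr// -[leRHS]mulrA ler_wpM2l ?(ltW e0)//.
by rewrite ler_wpM2l ?nrm_ge0// lerDl.
Qed.

(** [C] is a normed module over itself only, so the derivative of a complex
    function of a real variable is spelled out. *)
Definition rder (F : R -> C) (x : R) (c : C) := forall e : R, 0 < e ->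
  exists2 d : R, 0 < d &
  forall h, `|h| < d -> nrm (F (x + h) - F x - c * h%:C) <= e * `|h|.

Lemma has_der_rder h (x : R) c :
  has_der h x%:C c -> rder (fun s => h s%:C) x c.
Proof.
move=> hc e e0; have [d d0 dP] := hc e e0; exists d => // s sd.
by have := dP s%:C; rewrite nrm_real rmorphD; apply.
Qed.

Lemma rder_lin F G x c c' (a b : C) : rder F x c -> rder G x c' ->
  rder (fun s => a * F s + b * G s) x (a * c + b * c').
Proof.
move=> hF hG e e0.
pose m := nrm a + nrm b + 1.
have m0 : 0 < m by rewrite ltr_wpDl// addr_ge0 ?nrm_ge0.
have e1 : 0 < e / m by rewrite divr_gt0.
have [d d0 dP] := hF _ e1; have [d' d'0 d'P] := hG _ e1.
exists (Num.min d d'); first by rewrite lt_min d0.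
move=> s; rewrite lt_min => /andP[/dP h1 /d'P h2].
have -> : a * F (x + s) + b * G (x + s) - (a * F x + b * G x) -
    (a * c + b * c') * s%:C = a * (F (x + s) - F x - c * s%:C) +
    b * (G (x + s) - G x - c' * s%:C) by ring.
apply: le_trans (nrmD _ _) _; rewrite !nrmM.
have em : e / m * m = e by rewrite divfK// gt_eqF.
have h1' : nrm a * nrm (F (x + s) - F x - c * s%:C) <= nrm a * (e / m * `|s|).
  by rewrite ler_wpM2l ?nrm_ge0.
have h2' : nrm b * nrm (G (x + s) - G x - c' * s%:C) <= nrm b * (e / m * `|s|).
  by rewrite ler_wpM2l ?nrm_ge0.
apply: (le_trans (lerD h1' h2')).
rewrite -mulrDl mulrA ler_wpM2r// -[leRHS]em mulrC ler_wpM2l ?(ltW e1)//.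
by rewrite /m lerDl.
Qed.

Lemma rder_conj F x c : rder F x c -> rder (fun s => (F s)^*) x (c^*).
Proof.
move=> hF e e0; have [d d0 dP] := hF _ e0; exists d => // s /dP.
suff -> : (F (x + s))^* - (F x)^* - c^* * s%:C = (F (x + s) - F x - c * s%:C)^*.
  by rewrite nrm_conj.
by rewrite !rmorphB rmorphM; congr (_ - _ * _); rewrite /= oppr0.
Qed.

Lemma Re_mulr (z : C) (u : R) : complex.Re (z * u%:C) = complex.Re z * u.
Proof. by case: z => ? ? /=; ring. Qed.

Lemma rder_Re F x c : rder F x c ->
  is_derive x (1 : R) (fun s => complex.Re (F s)) (complex.Re c).
Proof.
move=> hF.
suff h : (fun h => h^-1 *: (((fun s => complex.Re (F s)) \o shift x) (h *: (1 : R)) -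
   complex.Re (F x))) @ (0 : R)^' --> complex.Re c.
  by split; [apply/cvg_ex; exists (complex.Re c) | apply: cvg_lim].
apply/cvgrPdist_le => e e0; have [d d0 dP] := hF _ e0.
near=> h => /=.
have h0 : h != 0 by near: h; exact: nbhs_dnbhs_neq.
have hd : `|h| < d by near: h; apply: dnbhs0_lt.
have := dP _ hd; rewrite -[h *: 1]/(h * 1) mulr1.
have : `|complex.Re (F (x + h) - F x - c * h%:C)| <= nrm (F (x + h) - F x - c * h%:C).
  exact: absRe_le_nrm.
move=> /le_trans /[apply].
have -> : complex.Re (F (x + h) - F x - c * h%:C) =
   complex.Re (F (x + h)) - complex.Re (F x) - complex.Re c * h.
  by rewrite !raddfB /= Re_mulr.
move=> H; rewrite distrC addrC -(ler_pM2r (_ : 0 < `|h|)) ?normr_gt0//.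
rewrite -normrM [x + h]addrC in H *.
apply: le_trans H; rewrite le_eqVlt; apply/orP; left; apply/eqP; congr `| _ |.
set u := complex.Re (F (h + x)) - _; rewrite [h^-1 *: u]/(h^-1 * u).
by rewrite mulrDl mulrAC mulVf// mul1r; ring.
Unshelve. all: by end_near. Qed.

Lemma rder_nondecr F c a b : a <= b ->
  (forall x, a <= x <= b -> rder F x (c x)) ->
  (forall x, a <= x <= b -> 0 <= complex.Re (c x)) ->
  complex.Re (F a) <= complex.Re (F b).
Proof.
move=> ab hF c0; rewrite -subr_ge0.
have h x : x \in `]a, b[%R -> is_derive x (1 : R) (fun s => complex.Re (F s)) (complex.Re (c x)).
  by rewrite in_itv => /andP[ax xb]; apply: rder_Re; apply: hF; rewrite !ltW.
have cont : {within `[a, b], continuous (fun s => complex.Re (F s))}.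
  apply: derivable_within_continuous => x; rewrite in_itv /= => xab.
  by have := rder_Re (hF _ xab) => -[].
have [y yab ->] := MVT_segment ab h cont.
by rewrite mulr_ge0// ?subr_ge0// c0// -in_itv.
Qed.

(** With [w] the increment of [F], the real part of [nrm w * G - w^* * F] has
    a nonnegative derivative. *)
Lemma mvt_le F G c d a b : a <= b ->
  (forall x, a <= x <= b -> rder F x (c x)) ->
  (forall x, a <= x <= b -> rder G x (d x)) ->
  (forall x, a <= x <= b -> nrm (c x) <= complex.Re (d x)) ->
  nrm (F b - F a) <= complex.Re (G b - G a).
Proof.
move=> ab hF hG cd.
pose w := F b - F a.
have [w0|w0] := eqVneq w 0.
  rewrite -/w w0 nrm0 raddfB subr_ge0 /=; apply: (rder_nondecr ab hG) => x xab.
  by apply: le_trans (cd _ xab); exact: nrm_ge0.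
pose K s := (nrm w)%:C * G s + (- w^*) * F s.
have hK x : a <= x <= b -> rder K x ((nrm w)%:C * d x + (- w^*) * c x).
  by move=> xab; apply: rder_lin; [exact: hG | exact: hF].
have := rder_nondecr ab hK.
have ReC (u : R) z : complex.Re (u%:C * z) = u * complex.Re z.
  by rewrite mulrC Re_mulr mulrC.
have K0 x : a <= x <= b -> 0 <= complex.Re ((nrm w)%:C * d x + - w^* * c x).
  move=> xab; rewrite raddfD /= ReC mulNr raddfN /= subr_ge0.
  apply: le_trans (Re_le_nrm _) _; rewrite nrmM nrm_conj.
  by rewrite ler_wpM2l ?nrm_ge0// cd.
move=> /(_ K0); rewrite -subr_ge0 -raddfB /= /K.
have -> : (nrm w)%:C * G b + - w^* * F b - ((nrm w)%:C * G a + - w^* * F a) =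
  (nrm w)%:C * (G b - G a) - w^* * w by rewrite /w; ring.
rewrite raddfB /= ReC Re_conjM subr_ge0 expr2 ler_pM2l//.
by rewrite nrm_gt0.
Qed.

Lemma rder_cst (u : C) x : rder (fun=> u) x 0.
Proof.
move=> e e0; exists 1 => // s _; rewrite subrr sub0r mul0r oppr0 nrm0.
by rewrite mulr_ge0// ltW.
Qed.

Lemma rder_id (u : C) x : rder (fun s => u * s%:C) x u.
Proof.
move=> e e0; exists 1 => // s _; rewrite rmorphD /= mulrDr.
by rewrite [u * _ + _]addrC addrK subrr nrm0 mulr_ge0// ltW.
Qed.

Lemma rder_uniq F G c a b : a <= b ->
  (forall x, a <= x <= b -> rder F x (c x)) ->
  (forall x, a <= x <= b -> rder G x (c x)) ->
  F b - F a = G b - G a.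
Proof.
move=> ab hF hG; apply/eqP; rewrite -subr_eq0; apply/eqP/nrm_eq0/eqP.
rewrite eq_le nrm_ge0 andbT.
have h x : a <= x <= b -> rder (fun s => 1 * F s + (-1) * G s) x (1 * c x + (-1) * c x).
  by move=> xab; apply: rder_lin; auto.
have := mvt_le ab h (fun x _ => rder_cst 0 x) => /=.
rewrite subrr /= => H.
have -> : F b - F a - (G b - G a) =
   1 * F b + -1 * G b - (1 * F a + -1 * G a) by ring.
by apply: H => x _; rewrite mul1r mulN1r subrr nrm0.
Qed.

End Derivative.

(** * Integrals of complex functions over a segment *)

Section Integral.
Context {R : realType}.
Local Notation C := R[i].
Local Notation mu := (@lebesgue_measure R).
Implicit Types (F G : R -> C) (a b c M : R).

(** The candidate is the integral from 0, written as a difference of two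
    integrals with the same left endpoint so as to cover negative [x]. *)
Lemma antiderivative_real (f : R -> R) : continuous f ->
  exists G : R -> R, forall x, is_derive x (1 : R) G (f x).
Proof.
move=> cf.
have intf a b : mu.-integrable `[a, b] (EFin \o f).
  apply: continuous_compact_integrable; first exact: segment_compact.
  by apply: continuous_subspaceT => x; exact: cf.
pose I a x := (\int[mu]_(t in `[a, x]) f t)%R.
pose G x := I (- (`|x| + 1)) x - I (- (`|x| + 1)) 0.
exists G => x.
have split a m b : a <= m -> m <= b -> I a b = I a m + I m b.
  move=> am mb.
  rewrite {3}/I -Rintegral_itv_obnd_cbnd; last first.
    by apply: integrableS (intf m b) => //; exact: subset_itv_oc_cc.
  by rewrite -(@Rintegral_itvB R f (BLeft a)) ?bnd_simp// addrC subrK.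
(* Near [x] the left endpoint in [G] may be replaced with a fixed one, to which
   the fundamental theorem of calculus applies. *)
pose M := `|x| + 2.
have GE y : `|y| < M -> G y = I (- (M + 1)) y - I (- (M + 1)) 0.
  move=> yM; rewrite /G.
  have Mb : - (M + 1) <= - (`|y| + 1) by rewrite lerN2 lerD2r ltW.
  rewrite (split _ _ y Mb); last by rewrite lerNl (le_trans (ler_norm _))// normrN lerDl.
  rewrite (split _ _ 0 Mb); first by ring.
  by rewrite oppr_le0 addr_ge0.
have [dI IE] : derivable (I (- (M + 1))) x (1 : R) /\ (I (- (M + 1)))^`()%classic x = f x.
  apply: (@continuous_FTC1_closed _ _ _ _ (x + 1)) => //.
  - by rewrite ltrDl.
  - by rewrite ltrNl (le_lt_trans (ler_norm _))// normrN /M -addrA ltrDl.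
  - exact: cf.
have dI' : is_derive x (1 : R) (fun y => I (- (M + 1)) y - I (- (M + 1)) 0) (f x).
  have -> : f x = f x - 0 by rewrite subr0.
  apply: is_deriveB.
  by rewrite -IE derive1E; exact: derivableP.
apply: near_eq_is_derive dI'.
near=> y; rewrite GE//.
have : `|y - x| < 1 by rewrite distrC; near: y; exact: cvgr_dist_lt.
rewrite /M => h; rewrite -(subrK x y) (le_lt_trans (ler_normD _ _))// addrC ltrD2l.
by rewrite (lt_trans h)// ltrDl.
Unshelve. all: by end_near. Qed.

Lemma is_derive_eps (k : R -> R) x c : is_derive x (1 : R) k c ->
  forall e, 0 < e -> exists2 d : R, 0 < d &
    forall h, `|h| < d -> `|k (x + h) - k x - c * h| <= e * `|h|.
Proof.
move=> dk e e0.
have /derivable_nbhsP /eqaddoP /(_ _ e0) : derivable k x (1 : R) by apply: ex_derive.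
move=> /nbhs_normP[d /= d0 dP].
exists d => // h hd.
have := dP h; rewrite /= sub0r normrN => /(_ hd).
rewrite derive_val.
suff -> : ((fun h0 => (k \o shift x) (h0 *: (1:R))) - (cst (k x) + *:%R^~ c)) h =
  k (x + h) - k x - c * h by [].
rewrite -[LHS]/(k (h * 1 + x) - (k x + h * c)).
by rewrite mulr1 opprD addrA [h + x]addrC [h * c]mulrC.
Qed.

Lemma continuous_Re (F : R -> C) : continuous F -> continuous (fun s => complex.Re (F s)).
Proof.
move=> cF x; apply/cvgrPdist_lt => e e0.
have e0' : 0 < e%:C by rewrite ltcR.
have /cvgrPdist_lt /(_ _ e0') := cF x; apply: filterS => y.
rewrite nrmE ltcR; apply: le_lt_trans.
by rewrite -raddfB; exact: absRe_le_nrm.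
Qed.

Lemma continuous_Im (F : R -> C) : continuous F -> continuous (fun s => complex.Im (F s)).
Proof.
move=> cF x; apply/cvgrPdist_lt => e e0.
have e0' : 0 < e%:C by rewrite ltcR.
have /cvgrPdist_lt /(_ _ e0') := cF x; apply: filterS => y.
rewrite nrmE ltcR; apply: le_lt_trans.
by rewrite -raddfB; exact: absIm_le_nrm.
Qed.

Lemma continuous_ReIm (u v : R -> R) : continuous u -> continuous v ->
  continuous (fun s => (u s +i* v s) : C).
Proof.
move=> cu cv x; apply/cvgrPdist_lt => e e0.
have eE : e = (complex.Re e)%:C by rewrite RRe_real// gtr0_real.
have e0' : 0 < complex.Re e / 2 by rewrite divr_gt0// -ltcR -eE.
have /cvgrPdist_lt /(_ _ e0') hu := cu x.
have /cvgrPdist_lt /(_ _ e0') hv := cv x.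
near=> y; rewrite nrmE eE ltcR (splitr (complex.Re e)).
apply: le_lt_trans (nrm_le_ReIm _) _; apply: ltrD => /=.
  by near: y.
by near: y.
Unshelve. all: by end_near. Qed.

Lemma antiderivative (F : R -> C) : continuous F ->
  exists G : R -> C, forall x, rder G x (F x).
Proof.
move=> cF.
have [u du] := antiderivative_real (continuous_Re cF).
have [v dv] := antiderivative_real (continuous_Im cF).
exists (fun s => u s +i* v s) => x e e0.
have e0' : 0 < e / 2 by rewrite divr_gt0.
have [d d0 dP] := is_derive_eps (du x) e0'.
have [d' d'0 d'P] := is_derive_eps (dv x) e0'.
exists (Num.min d d'); first by rewrite lt_min d0.
move=> h; rewrite lt_min => /andP[/dP h1 /d'P h2].
apply: le_trans (nrm_le_ReIm _) _; rewrite (splitr e) mulrDl.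
have -> : (u (x + h) +i* v (x + h)) - (u x +i* v x) - F x * h%:C =
  (u (x + h) - u x - complex.Re (F x) * h) +i* (v (x + h) - v x - complex.Im (F x) * h).
  by case: (F x) => p q; apply/eqP; rewrite eq_complex /=; apply/andP; split; apply/eqP; ring.
exact: lerD.
Qed.

(** The integral [cint] is the increment of a chosen antiderivative; its
    properties then come from the mean value inequality and from
    the uniqueness of antiderivatives. *)
Definition prim (F : R -> C) : R -> C :=
  if pselect (exists G : R -> C, forall x, rder G x (F x)) is left h
  then projT1 (cid h) else (fun=> 0).

Lemma primP F : continuous F -> forall x, rder (prim F) x (F x).
Proof.
move=> cF; rewrite /prim; case: pselect => [h|/(_ (antiderivative cF))//].
by case: (cid h).
Qed.

Definition cint (a b : R) (F : R -> C) : C := prim F b - prim F a.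

Lemma cintE a b F G : a <= b -> continuous F ->
  (forall x, a <= x <= b -> rder G x (F x)) -> cint a b F = G b - G a.
Proof.
by move=> ab cF hG; apply: (rder_uniq ab _ hG) => x _; exact: primP.
Qed.

Lemma cint_lin a b F G (u v : C) : a <= b -> continuous F -> continuous G ->
  cint a b (fun s => u * F s + v * G s) = u * cint a b F + v * cint a b G.
Proof.
move=> ab cF cG.
rewrite (@cintE a b _ (fun s => u * prim F s + v * prim G s) ab).
- by rewrite /cint; ring.
- move=> x; apply: (@cvgD _ _ _ _ _ (fun s => u * F s) (fun s => v * G s)); apply: cvgMr;
  [exact: cF|exact: cG].
- by move=> x _; apply: rder_lin; exact: primP.
Qed.

Lemma cintZ a b F (u : C) : a <= b -> continuous F ->
  cint a b (fun s => u * F s) = u * cint a b F.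
Proof.
move=> ab cF; have := cint_lin u 0 ab cF cF.
rewrite mul0r addr0 => <-; congr cint; apply/funext => s.
by rewrite mul0r addr0.
Qed.

Lemma cintD a b F G : a <= b -> continuous F -> continuous G ->
  cint a b (fun s => F s + G s) = cint a b F + cint a b G.
Proof.
move=> ab cF cG; have := cint_lin 1 1 ab cF cG.
rewrite !mul1r => <-; congr cint; apply/funext => s.
by rewrite !mul1r.
Qed.

Lemma cintB a b F G : a <= b -> continuous F -> continuous G ->
  cint a b (fun s => F s - G s) = cint a b F - cint a b G.
Proof.
move=> ab cF cG; have := cint_lin 1 (-1) ab cF cG.
rewrite mul1r mulN1r => <-; congr cint; apply/funext => s.
by rewrite mul1r mulN1r.
Qed.

Lemma cint_cst a b (u : C) : a <= b -> cint a b (fun=> u) = u * (b - a)%:C.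
Proof.
move=> ab; rewrite (@cintE _ _ _ (fun s => u * s%:C))//.
- by rewrite rmorphB mulrBr.
- exact: cst_continuous.
- by move=> x _; exact: rder_id.
Qed.

Lemma continuous_conj (F : R -> C) : continuous F -> continuous (fun s => (F s)^*).
Proof.
move=> cF x; apply/cvgrPdist_lt => e e0.
have /cvgrPdist_lt /(_ _ e0) := cF x; apply: filterS => y.
by rewrite -rmorphB !nrmE nrm_conj.
Qed.

Lemma cint_conj a b F : a <= b -> continuous F ->
  cint a b (fun s => (F s)^*) = (cint a b F)^*.
Proof.
move=> ab cF; rewrite (@cintE a b _ (fun s => (prim F s)^*) ab).
- by rewrite /cint rmorphB.
- exact: continuous_conj.
- by move=> x _; apply: rder_conj; exact: primP.
Qed.

Lemma cint_le a b F G : a <= b -> continuous F -> continuous G ->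
  (forall x, a <= x <= b -> nrm (F x) <= complex.Re (G x)) ->
  nrm (cint a b F) <= complex.Re (cint a b G).
Proof.
move=> ab cF cG FG; rewrite /cint.
have hF x : a <= x <= b -> rder (prim F) x (F x) by move=> _; exact: primP.
have hG x : a <= x <= b -> rder (prim G) x (G x) by move=> _; exact: primP.
exact: mvt_le ab hF hG FG.
Qed.

Lemma cint_bound a b F (M : R) : a <= b -> continuous F ->
  (forall x, a <= x <= b -> nrm (F x) <= M) ->
  nrm (cint a b F) <= M * (b - a).
Proof.
move=> ab cF FM.
have := @cint_le _ _ F (fun=> M%:C) ab cF (@cst_continuous _ _ _) FM.
by rewrite cint_cst// Re_mulr.
Qed.

End Integral.

(** * The complex exponential *)

Section Exponential.
Context {R : realType}.
Local Notation C := R[i].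
Implicit Types (x y r s t : R) (z w : C).

Definition cis t : C := cos t +i* sin t.

Lemma cisD s t : cis (s + t) = cis s * cis t.
Proof.
apply/eqP; rewrite eq_complex /= cosD sinD eqxx /=; apply/eqP.
by rewrite addrC; congr (_ + _); rewrite mulrC.
Qed.

Lemma cis0 : cis 0 = 1.
Proof. by apply/eqP; rewrite eq_complex /= cos0 sin0 !eqxx. Qed.

Lemma nrm_cis t : nrm (cis t) = 1.
Proof.
apply/eqP; rewrite -(@eqrXn2 _ 2) ?nrm_ge0//.
by rewrite nrm_sqr /= cos2Dsin2 expr1n.
Qed.

Lemma cis_neq0 t : cis t != 0.
Proof. by apply/eqP => h; have := nrm_cis t; rewrite h nrm0; lra. Qed.

Lemma cis_conj t : (cis t)^* = cis (- t).
Proof. by rewrite /cis cosN sinN. Qed.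

Lemma cisVJ t : (cis t)^-1 = cis (- t).
Proof.
by apply: (mulfI (cis_neq0 t)); rewrite mulfV ?cis_neq0// -cisD subrr cis0.
Qed.

Lemma cis2pi : cis (pi *+ 2) = 1.
Proof. by apply/eqP; rewrite eq_complex /= cos2pi sin2pi !eqxx. Qed.

Lemma continuous_cis : continuous cis.
Proof. by apply: continuous_ReIm; [exact: continuous_cos|exact: continuous_sin]. Qed.

Definition cexp z : C := (expR (complex.Re z))%:C * cis (complex.Im z).

Lemma cexpD z w : cexp (z + w) = cexp z * cexp w.
Proof. by rewrite /cexp !raddfD /= expRD cisD rmorphM /=; ring. Qed.

Lemma nrm_cexp z : nrm (cexp z) = expR (complex.Re z).
Proof. by rewrite nrmM nrm_cis mulr1 nrm_real ger0_norm// expR_ge0. Qed.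

Lemma cexp_neq0 z : cexp z != 0.
Proof.
by apply/eqP => h; have := nrm_cexp z; rewrite h nrm0; have := expR_gt0 (complex.Re z); lra.
Qed.

Lemma has_der_cexp0 : has_der cexp 0 1.
Proof.
move=> e e0.
(* Of the four terms of the error, one counts once, one twice and two three
   times the bound [e' * nrm w], which adds up to 9. *)
have [e' [e'0 e'1 e'e]] : exists e' : R, [/\ 0 < e', e' <= 1 & e' * 9 <= e].
  exists (Num.min (e / 9) 1); split; first by rewrite lt_min divr_gt0//=.
    by rewrite ge_min lexx orbT.
  by rewrite -ler_pdivlMr// ge_min lexx.
have [d1 d10 P1] := is_derive_eps (is_derive_expR (0 : R)) e'0.
have [d2 d20 P2] := is_derive_eps (is_derive_cos (0 : R)) e'0.
have [d3 d30 P3] := is_derive_eps (is_derive_sin (0 : R)) e'0.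
pose d := Num.min (Num.min d1 d2) (Num.min d3 e').
exists d; first by rewrite !lt_min d10 d20 d30 e'0.
move=> [x y] wd.
have := absRe_le_nrm (x +i* y); have := absIm_le_nrm (x +i* y) => /=.
move: wd; set N := nrm (_ +i* _); rewrite !lt_min => /andP[/andP[w1 w2] /andP[w3 w4]] yN xN.
have := P1 x (le_lt_trans xN w1); rewrite add0r expR0 mul1r.
have := P2 y (le_lt_trans yN w2); rewrite add0r cos0 sin0 oppr0 mul0r subr0.
have := P3 y (le_lt_trans yN w3); rewrite add0r cos0 sin0 subr0 mul1r.
set g := sin y - y; set b := cos y - 1; set al := expR x - 1 - x => hg hb ha.
have -> : cexp (0 + (x +i* y)) - cexp 0 - 1 * (x +i* y) =
  (al + b * (1 + x + al)) +i* ((x + al) * y + g * (1 + x + al)).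
  rewrite add0r /cexp cis0 expR0; apply/eqP; rewrite eq_complex /= /al /b /g.
  by apply/andP; split; apply/eqP; ring.
apply: le_trans (nrm_le_ReIm _) _ => /=.
have N0 : 0 <= N by exact: nrm_ge0.
have e0' : 0 <= e' := ltW e'0.
have X1 : `|x| <= 1 by lra.
have ha' : `|al| <= e' * N by apply: le_trans ha _; rewrite ler_wpM2l.
have hb' : `|b| <= e' * N by apply: le_trans hb _; rewrite ler_wpM2l.
have hg' : `|g| <= e' * N by apply: le_trans hg _; rewrite ler_wpM2l.
have eN : e' * N <= N by rewrite ler_piMl.
have T : `|1 + x + al| <= 3.
  have := ler_normD (1 + x) al; have := ler_normD 1 x; rewrite normr1.
  by lra.
have U : `|x + al| <= 2 * N by have := ler_normD x al; lra.
have V1 : `|b * (1 + x + al)| <= (e' * N) * 3 by rewrite normrM ler_pM.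
have V2 : `|g * (1 + x + al)| <= (e' * N) * 3 by rewrite normrM ler_pM.
have V3 : `|(x + al) * y| <= (2 * N) * e' by rewrite normrM ler_pM//; lra.
have := ler_normD al (b * (1 + x + al)).
have := ler_normD ((x + al) * y) (g * (1 + x + al)).
have E9 : e' * 9 * N <= e * N by rewrite ler_wpM2r.
by lra.
Qed.

Lemma has_der_cexp z : has_der cexp z (cexp z).
Proof.
move=> e e0.
have n0 : 0 < nrm (cexp z) by rewrite nrm_gt0 ?cexp_neq0.
have [d d0 dP] := has_der_cexp0 (divr_gt0 e0 n0); exists d => // w /dP.
rewrite add0r mul1r => h; rewrite cexpD.
have -> : cexp z * cexp w - cexp z - cexp z * w = cexp z * (cexp w - cexp 0 - w).
  by rewrite [cexp 0]/cexp expR0 cis0; ring.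
by rewrite nrmM -ler_pdivlMl// mulrA [_^-1 * _]mulrC.
Qed.

Lemma differentiable_cexp z : differentiable cexp z.
Proof. by have [] := has_der_diff (has_der_cexp z). Qed.

End Exponential.

(** * Goursat's theorem and the mean value property *)

Section Goursat.
Context {R : realType}.
Local Notation C := R[i].
Implicit Types (a b p q r s t x y : R) (z w : C).

(** The integral of [H] along the positively oriented boundary of the
    rectangle with sides [a, b] and [p, q], one term for each side. *)
Definition rect_int (H : C -> C) a b p q : C :=
  cint a b (fun s => H (s +i* p)) - cint a b (fun s => H (s +i* q)) +
  'i * (cint p q (fun t => H (b +i* t)) - cint p q (fun t => H (a +i* t))).

Lemma rect_int_split H a m b p n q : rect_int H a b p q =
  rect_int H a m p n + rect_int H m b p n + (rect_int H a m n q + rect_int H m b n q).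
Proof. by rewrite /rect_int /cint; ring. Qed.

Lemma continuous_hline (H : C -> C) p : continuous H -> continuous (fun s => H (s +i* p)).
Proof.
move=> cH s; apply: (@continuous_comp _ _ _ (fun s => s +i* p : C) H); last exact: cH.
by apply: (continuous_ReIm (u := id) (v := cst p)) => ?; [exact: cvg_id|exact: cst_continuous].
Qed.

Lemma continuous_vline (H : C -> C) a : continuous H -> continuous (fun t => H (a +i* t)).
Proof.
move=> cH s; apply: (@continuous_comp _ _ _ (fun s => a +i* s : C) H); last exact: cH.
by apply: (continuous_ReIm (u := cst a) (v := id)) => ?; [exact: cst_continuous|exact: cvg_id].
Qed.

(** The affine part of [H] at [z] integrates to 0 around the rectangle, so
    that only the remainder counts. *)
Lemma rect_int_small H a b p q z c (e : R) : continuous H -> a <= b -> p <= q -> 0 <= e ->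
  (forall s t, a <= s <= b -> p <= t <= q ->
     nrm (H (s +i* t) - H z - c * ((s +i* t) - z)) <= e) ->
  nrm (rect_int H a b p q) <= 2 * e * ((b - a) + (q - p)).
Proof.
move=> cH ab pq e0 small.
have chl p' := continuous_hline (p := p') cH.
have cvl a' := continuous_vline (a := a') cH.
have cc (u : C) : continuous (fun _ : R => u) by move=> ?; exact: cst_continuous.
pose r s t := H (s +i* t) - H z - c * ((s +i* t) - z).
have hE : cint a b (fun s => H (s +i* p)) - cint a b (fun s => H (s +i* q)) =
  cint a b (fun s => (H (s +i* p) - H (s +i* q)) - c * (0 +i* (p - q))) +
  c * (0 +i* (p - q)) * (b - a)%:C.
  rewrite cintB//; last by move=> s;
    apply: (@cvgB _ _ _ _ _ (fun s => H (s +i* p)) (fun s => H (s +i* q))); [exact: chl|exact: chl].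
  by rewrite cintB// cint_cst// subrK.
have vE : cint p q (fun t => H (b +i* t)) - cint p q (fun t => H (a +i* t)) =
  cint p q (fun t => (H (b +i* t) - H (a +i* t)) - c * (b - a)%:C) +
  c * (b - a)%:C * (q - p)%:C.
  rewrite cintB//; last by move=> s;
    apply: (@cvgB _ _ _ _ _ (fun s => H (b +i* s)) (fun s => H (a +i* s))); [exact: cvl|exact: cvl].
  by rewrite cintB// cint_cst// subrK.
rewrite /rect_int hE vE mulrDr.
set I1 := cint a b _; set I2 := cint p q _.
have -> : I1 + c * (0 +i* (p - q)) * (b - a)%:C + ('i * I2 + 'i * (c * (b - a)%:C * (q - p)%:C)) =
   I1 + 'i * I2.
  have -> : (0 +i* (p - q)) = - ('i * (q - p)%:C) :> C.
    by apply/eqP; rewrite eq_complex /=; apply/andP; split; apply/eqP; ring.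
  by ring.
have i1 : nrm ('i%C : C) = 1.
  by rewrite nrmcE /= expr0n expr1n add0r sqrtr1.
have B1 : nrm I1 <= (2 * e) * (b - a).
  apply: cint_bound => //.
    move=> s; apply: cvgB; last exact: cst_continuous.
    by apply: (@cvgB _ _ _ _ _ (fun s => H (s +i* p)) (fun s => H (s +i* q))); exact: chl.
  move=> s sab.
  have -> : H (s +i* p) - H (s +i* q) - c * (0 +i* (p - q)) = r s p - r s q.
    rewrite /r; have -> : (0 +i* (p - q)) = (s +i* p) - (s +i* q) :> C.
      by apply/eqP; rewrite eq_complex /= subrr !eqxx.
    by ring.
  apply: le_trans (nrmB _ _) _; rewrite mulr_natl mulr2n.
  by apply: lerD; apply: small => //; rewrite lexx pq.
have B2 : nrm I2 <= (2 * e) * (q - p).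
  apply: cint_bound => //.
    move=> s; apply: cvgB; last exact: cst_continuous.
    by apply: (@cvgB _ _ _ _ _ (fun s => H (b +i* s)) (fun s => H (a +i* s))); exact: cvl.
  move=> t tpq.
  have -> : H (b +i* t) - H (a +i* t) - c * (b - a)%:C = r b t - r a t.
    rewrite /r; have -> : (b - a)%:C = (b +i* t) - (a +i* t) :> C.
      by apply/eqP; rewrite eq_complex /= subrr !eqxx.
    by ring.
  apply: le_trans (nrmB _ _) _; rewrite mulr_natl mulr2n.
  by apply: lerD; apply: small => //; rewrite lexx ab.
apply: le_trans (nrmD _ _) _; rewrite nrmM i1 mul1r mulrDr.
exact: lerD.
Qed.

(** One of the four quarters of a rectangle carries at least a fourth of the
    integral. The nested rectangles obtained in this way shrink to a point,
    where [rect_int_small] makes the integral negligible compared with the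
    area. *)
Lemma goursat (H : C -> C) a b p q : (forall z, differentiable H z) ->
  a <= b -> p <= q -> rect_int H a b p q = 0.
Proof.
move=> dH ab pq.
have cH : continuous H by move=> z; exact: differentiable_continuous.
pose W := b - a; pose V := q - p.
have W0 : 0 <= W by rewrite subr_ge0.
have V0 : 0 <= V by rewrite subr_ge0.
pose h k : R := 2^-1 ^+ k.
have h0 k : 0 < h k by rewrite exprn_gt0.
have hS k : h k.+1 + h k.+1 = h k by rewrite /h exprS; lra.
pose J k (u : R * R) := nrm (rect_int H u.1 (u.1 + W * h k) u.2 (u.2 + V * h k)).
have step k (u : R * R) : exists v : R * R,
   [/\ u.1 <= v.1, v.1 + W * h k.+1 <= u.1 + W * h k,
       u.2 <= v.2, v.2 + V * h k.+1 <= u.2 + V * h k & J k u <= 4 * J k.+1 v].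
  have Wk : 0 <= W * h k.+1 by rewrite mulr_ge0// ltW.
  have Vk : 0 <= V * h k.+1 by rewrite mulr_ge0// ltW.
  pose m := u.1 + W * h k.+1; pose n := u.2 + V * h k.+1.
  have := rect_int_split H u.1 m (u.1 + W * h k) u.2 n (u.2 + V * h k).
  have -> : u.1 + W * h k = m + W * h k.+1 by rewrite /m -addrA -mulrDr hS.
  have -> : u.2 + V * h k = n + V * h k.+1 by rewrite /n -addrA -mulrDr hS.
  rewrite /J.
  have -> : u.1 + W * h k = m + W * h k.+1 by rewrite /m -addrA -mulrDr hS.
  have -> : u.2 + V * h k = n + V * h k.+1 by rewrite /n -addrA -mulrDr hS.
  move=> ->.
  set A1 := rect_int H u.1 m u.2 n; set A2 := rect_int H m _ u.2 n.
  set A3 := rect_int H u.1 m n _; set A4 := rect_int H m _ n _.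
  have T : nrm (A1 + A2 + (A3 + A4)) <= nrm A1 + nrm A2 + (nrm A3 + nrm A4).
    by apply: le_trans (nrmD _ _) _; apply: lerD; exact: nrmD.
  have [H1|H1] := lerP (nrm (A1 + A2 + (A3 + A4))) (4 * nrm A1).
    by exists (u.1, u.2); rewrite /= -/m -/n; split=> //; rewrite /m /n; lra.
  have [H2|H2] := lerP (nrm (A1 + A2 + (A3 + A4))) (4 * nrm A2).
    by exists (m, u.2); rewrite /= -/m -/n; split=> //; rewrite /m /n; lra.
  have [H3|H3] := lerP (nrm (A1 + A2 + (A3 + A4))) (4 * nrm A3).
    by exists (u.1, n); rewrite /= -/m -/n; split=> //; rewrite /m /n; lra.
  have [H4|H4] := lerP (nrm (A1 + A2 + (A3 + A4))) (4 * nrm A4).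
    by exists (m, n); rewrite /= -/m -/n; split=> //; rewrite /m /n; lra.
  by exfalso; lra.
pose nxt k u := projT1 (cid (step k u)).
have nxtP k u := projT2 (cid (step k u)).
pose S := fix S k := if k is k'.+1 then nxt k' (S k') else (a, p).
have mono k j : [/\ (S k).1 <= (S (k + j)%N).1, (S (k + j)%N).1 + W * h (k + j)%N <= (S k).1 + W * h k,
     (S k).2 <= (S (k + j)%N).2 & (S (k + j)%N).2 + V * h (k + j)%N <= (S k).2 + V * h k].
  elim: j => [|j [i1 i2 i3 i4]]; first by rewrite addn0.
  rewrite addnS; have [j1 j2 j3 j4 _] := nxtP (k + j)%N (S (k + j)%N).
  by split; [apply: le_trans i1 _|apply: le_trans j2 _|apply: le_trans i3 _|apply: le_trans j4 _].
have below k j : (S k).1 <= (S j).1 + W * h j /\ (S k).2 <= (S j).2 + V * h j.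
  have Wk i : 0 <= W * h i by rewrite mulr_ge0// ltW.
  have Vk i : 0 <= V * h i by rewrite mulr_ge0// ltW.
  have [kj|jk] := leqP k j.
    have [i1 _ i3 _] := mono k (j - k)%N; rewrite subnKC// in i1 i3.
    by have := Wk j; have := Vk j; lra.
  have [_ i2 _ i4] := mono j (k - j)%N; rewrite subnKC 1?ltnW// in i2 i4.
  by have := Wk k; have := Vk k; lra.
pose x := sup (range (fun k => (S k).1)); pose y := sup (range (fun k => (S k).2)).
have xP k : (S k).1 <= x <= (S k).1 + W * h k.
  apply/andP; split.
    apply: ub_le_sup; last by exists k.
    by exists ((S 0%N).1 + W * h 0%N) => _ [j _ <-]; exact: (below _ _).1.
  apply: ge_sup; first by exists (S 0%N).1; exists 0%N.
  by move=> _ [j _ <-]; exact: (below _ _).1.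
have yP k : (S k).2 <= y <= (S k).2 + V * h k.
  apply/andP; split.
    apply: ub_le_sup; last by exists k.
    by exists ((S 0%N).2 + V * h 0%N) => _ [j _ <-]; exact: (below _ _).2.
  apply: ge_sup; first by exists (S 0%N).2; exists 0%N.
  by move=> _ [j _ <-]; exact: (below _ _).2.
have JS k : J 0%N (a, p) <= 4 ^+ k * J k (S k).
  elim: k => [|k ih]; first by rewrite mul1r.
  apply: le_trans ih _; rewrite exprSr -mulrA ler_wpM2l ?exprn_ge0//.
  by have [_ _ _ _] := nxtP k (S k).
apply: nrm_eq0; apply/eqP; rewrite eq_le nrm_ge0 andbT leNgt; apply/negP => I0.
have J0E : J 0%N (a, p) = nrm (rect_int H a b p q).
  by rewrite /J /h /= !mulr1 /W /V addrCA subrr addr0 addrCA subrr addr0.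
rewrite -J0E in I0; set I := J 0%N (a, p) in I0 JS.
pose D := W + V + 1.
have D0 : 0 < D by rewrite /D; lra.
pose e := I / (4 * D ^+ 2).
have e0 : 0 < e by rewrite divr_gt0// mulr_gt0// exprn_gt0.
have [d d0 dP] := diff_has_der (dH (x +i* y)) e0.
set c := 'd H _ _ in dP.
have [k kd] : exists k, D * h k < d.
  exists (Num.bound (D / d)).
  have := archi_boundP (ltW (divr_gt0 D0 d0)); set k := Num.bound _ => kD.
  rewrite /h exprVn ltr_pdivrMr ?exprn_gt0// -ltr_pdivrMl// mulrC.
  apply: lt_trans kD _; rewrite -natrX ltr_nat; exact: ltn_expl.
have Jk : J k (S k) <= 2 * (e * (D * h k)) * (D * h k).
  have hk := h0 k.
  have xk := xP k; have yk := yP k.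
  have WV : W * h k + V * h k <= D * h k by rewrite -mulrDl ler_wpM2r ?(ltW hk)// /D lerDl.
  have : J k (S k) <= 2 * (e * (D * h k)) * (((S k).1 + W * h k - (S k).1) + ((S k).2 + V * h k - (S k).2)).
    apply: (@rect_int_small _ _ _ _ _ (x +i* y) c) => //.
    - by rewrite lerDl mulr_ge0// ltW.
    - by rewrite lerDl mulr_ge0// ltW.
    - by rewrite mulr_ge0 ?(ltW e0)// mulr_ge0// ltW.
    move=> s t /andP[s1 s2] /andP[t1 t2].
    have := dP ((s +i* t) - (x +i* y)); rewrite [x +i* y + _]addrC subrK.
    have nD : nrm ((s +i* t) - (x +i* y)) <= D * h k.
      apply: le_trans (nrm_le_ReIm _) _ => /=.
      apply: le_trans WV; apply: lerD; rewrite ler_norml; lra.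
    move=> /(_ (le_lt_trans nD kd)) /le_trans; apply.
    by rewrite ler_wpM2l// ltW.
  move=> /le_trans; apply; apply: ler_wpM2l; last by lra.
  by rewrite mulr_ge0// mulr_ge0 ?(ltW e0)// mulr_ge0// ltW.
have := JS k; have hk4 : h k * h k * 4 ^+ k = 1.
  by rewrite /h -!exprMn; have -> : 2^-1 * 2^-1 * 4 = 1 :> R by [lra|field]; rewrite expr1n.
have e2 : 2 * (e * (D * h k)) * (D * h k) * 4 ^+ k = I / 2.
  have -> : 2 * (e * (D * h k)) * (D * h k) * 4 ^+ k = 2 * e * D ^+ 2 * (h k * h k * 4 ^+ k) by ring.
  by rewrite hk4 /e; field; rewrite gt_eqF.
have : 4 ^+ k * J k (S k) <= I / 2.
  by rewrite -e2 mulrC; apply: ler_wpM2r; [exact: exprn_ge0|exact: Jk].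
lra.
Qed.

Lemma continuous_radius (h : C -> C) (r : C) : continuous h -> continuous (fun t => h (r * cis t)).
Proof.
move=> ch t; apply: (@continuous_comp _ _ _ (fun t => r * cis t) h); last exact: ch.
by apply: cvgMr; exact: continuous_cis.
Qed.

(** The composite of [h] with the exponential is holomorphic on the whole
    plane. On a rectangle of height [2 * pi] the horizontal sides cancel by
    periodicity, and the vertical sides are integrals over circles around 0,
    which therefore do not depend on the radius; let the radius tend to 0.
    The point 0 is exempted for the sake of the difference quotients in
    [cauchy_derivative]. *)
Lemma mean_value (h : C -> C) r : continuous h ->
  (forall z, z != 0 -> differentiable h z) -> 0 < r ->
  cint 0 (pi *+ 2) (fun t => h (r%:C * cis t)) = h 0 * (pi *+ 2)%:C.
Proof.
move=> ch dh r0.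
have pi2 : 0 <= (pi *+ 2 : R) by rewrite mulrn_wge0// pi_ge0.
pose K s := cint 0 (pi *+ 2) (fun t => h ((expR s)%:C * cis t)).
have KE s1 s2 : s1 <= s2 -> K s1 = K s2.
  move=> s12.
  have dH z : differentiable (h \o cexp) z.
    apply: differentiable_comp; first exact: differentiable_cexp.
    exact/dh/cexp_neq0.
  have := goursat dH s12 pi2.
  rewrite /rect_int.
  have -> : (fun s => (h \o cexp) (s +i* (pi *+ 2))) = (fun s => (h \o cexp) (s +i* 0)).
    by apply/funext => s; rewrite /= /cexp /= cis2pi cis0.
  rewrite subrr add0r => /eqP; rewrite mulf_eq0 => /orP[|].
    by rewrite eq_complex /= oner_eq0 andbF.
  by rewrite subr_eq0 => /eqP E; rewrite /K; exact: (esym E).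
have Kr : K (ln r) = cint 0 (pi *+ 2) (fun t => h (r%:C * cis t)).
  by rewrite /K lnK.
rewrite -Kr; apply/eqP; rewrite -subr_eq0; apply/eqP/nrm_eq0/eqP.
rewrite eq_le nrm_ge0 andbT; apply/ler_addgt0Pl => e e0; rewrite addr0.
have e1 : 0 < e / (pi *+ 2) by rewrite divr_gt0// mulrn_wgt0// pi_gt0.
have /nrm_nbhs[d d0 dP] : nbhs (0 : C) [set z | nrm (h z - h 0) <= e / (pi *+ 2)].
  have e1' : 0 < (e / (pi *+ 2))%:C by rewrite ltcR.
  have /cvgrPdist_le /(_ _ e1') := ch 0; apply: filterS => z.
  by rewrite nrmE lecR nrm_distC.
pose s := Num.min (ln r) (ln (d / 2)).
have d2 : 0 < d / 2 by rewrite divr_gt0.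
rewrite -(KE s); last by rewrite ge_min lexx.
have pi2E : (pi *+ 2 : R)%:C = (pi *+ 2 - 0)%:C by rewrite subr0.
rewrite pi2E -cint_cst// -cintB//; last 2 first.
- exact: continuous_radius.
- exact: cst_continuous.
have -> : e = e / (pi *+ 2) * (pi *+ 2 - 0).
  by rewrite subr0 divfK// gt_eqF// mulrn_wgt0// pi_gt0.
apply: cint_bound => //.
  move=> t; apply: cvgB; last exact: cst_continuous.
  exact: (@continuous_radius h (expR s)%:C ch).
move=> t _; rewrite -[_ * cis t]add0r; apply: dP.
rewrite nrmM nrm_cis mulr1 nrm_real ger0_norm ?expR_ge0//.
have : s <= ln (d / 2) by rewrite ge_min lexx orbT.
by rewrite -ler_expR lnK// => /le_lt_trans; apply; lra.
Qed.

End Goursat.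

(** * Means over circles and Cauchy's formula for the derivative *)

Section Average.
Context {R : realType}.
Local Notation C := R[i].
Implicit Types (F G : R -> C) (r M : R) (u : C) (h : C -> C).

Definition avg F : C := ((pi *+ 2)^-1)%:C * cint 0 (pi *+ 2) F.

Let pi2_gt0 : 0 < pi *+ 2 :> R.
Proof. by rewrite mulrn_wgt0// pi_gt0. Qed.

Let pi2_ge0 : 0 <= pi *+ 2 :> R.
Proof. exact: ltW. Qed.

Let pi2V (x : R) : (pi *+ 2)^-1 * (x * (pi *+ 2 - 0)) = x.
Proof. by rewrite subr0 mulrC mulfK// gt_eqF. Qed.

Lemma avg_le F G : continuous F -> continuous G ->
  (forall t, nrm (F t) <= complex.Re (G t)) -> nrm (avg F) <= complex.Re (avg G).
Proof.
move=> cF cG FG; rewrite /avg nrmM nrm_real ger0_norm ?invr_ge0//.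
rewrite [_ * cint _ _ G]mulrC Re_mulr mulrC ler_wpM2r ?invr_ge0//.
by apply: cint_le => // x _; exact: FG.
Qed.

Lemma avg_bound F M : continuous F -> (forall t, nrm (F t) <= M) -> nrm (avg F) <= M.
Proof.
move=> cF FM; rewrite /avg nrmM nrm_real ger0_norm ?invr_ge0//.
rewrite -[leRHS]pi2V ler_wpM2l ?invr_ge0//.
by apply: cint_bound => // x _; exact: FM.
Qed.

Lemma avgD F G : continuous F -> continuous G ->
  avg (fun t => F t + G t) = avg F + avg G.
Proof. by move=> cF cG; rewrite /avg cintD// mulrDr. Qed.

Lemma avgB F G : continuous F -> continuous G ->
  avg (fun t => F t - G t) = avg F - avg G.
Proof. by move=> cF cG; rewrite /avg cintB// mulrBr. Qed.

Lemma avgZ F u : continuous F -> avg (fun t => u * F t) = u * avg F.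
Proof. by move=> cF; rewrite /avg cintZ// mulrCA. Qed.

Lemma avg_conj F : continuous F -> avg (fun t => (F t)^*) = (avg F)^*.
Proof. by move=> cF; rewrite /avg cint_conj// rmorphM; congr (_ * _); rewrite /= oppr0. Qed.

Lemma avg_cst u : avg (fun=> u) = u.
Proof.
rewrite /avg cint_cst// subr0 mulrCA -rmorphM mulVf ?mulr1//.
by rewrite gt_eqF.
Qed.

Lemma avg_mean h r : continuous h ->
  (forall z, z != 0 -> differentiable h z) -> 0 < r ->
  avg (fun t => h (r%:C * cis t)) = h 0.
Proof.
move=> ch dh r0; rewrite /avg mean_value// mulrCA -rmorphM mulVf ?mulr1//.
by rewrite gt_eqF.
Qed.

Lemma continuous_cisN : continuous (fun t => cis (- t) : C).
Proof.
move=> t; apply: (@continuous_comp _ _ _ (fun t => - t) cis); last exact: continuous_cis.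
exact: opp_continuous.
Qed.

Lemma avg_cis : avg (fun t => cis t) = 0.
Proof.
have cid : continuous (id : C -> C) by move=> ?; exact: cvg_id.
have := @avg_mean id 1 cid _ ltr01; rewrite /= => <-.
  by congr avg; apply/funext => t; rewrite mul1r.
by move=> z _.
Qed.

Lemma avg_cisN : avg (fun t => cis (- t)) = 0.
Proof.
have -> : (fun t => cis (- t)) = (fun t => (cis t)^* : C).
  by apply/funext => t; rewrite cis_conj.
by rewrite avg_conj ?avg_cis ?conjc0//; exact: continuous_cis.
Qed.

Lemma has_der_near h k z c (d : R) : 0 < d ->
  (forall w, nrm w < d -> h (z + w) = k (z + w)) -> has_der h z c -> has_der k z c.
Proof.
move=> d0 hk hc e e0; have [d' d'0 dP] := hc e e0.
exists (Num.min d d'); first by rewrite lt_min d0.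
move=> w; rewrite lt_min => /andP[wd wd'].
by rewrite -hk// -[k z](_ : h z = _) ?dP// -[z]addr0 hk// nrm0.
Qed.

Lemma has_der_continuous h z c : has_der h z c -> {for z, continuous h}.
Proof. by move=> /has_der_diff[dh _]; exact: differentiable_continuous. Qed.

(** The mean value property of the difference quotient
    [(h z - h 0) / z], extended by [c] at 0. *)
Lemma cauchy_derivative h c r : (forall z, differentiable h z) ->
  has_der h 0 c -> 0 < r -> avg (fun t => h (r%:C * cis t) * cis (- t)) = c * r%:C.
Proof.
move=> dh hc r0.
have ch : continuous h by move=> z; exact: differentiable_continuous.
pose k z := if z == 0 then c else (h z - h 0) * z^-1.
have dk z : z != 0 -> differentiable k z.
  move=> z0.
  have dq : differentiable (fun y => (h y - h 0) * y^-1) z.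
    apply: differentiableM; first by apply: differentiableB.
    exact: differentiableV.
  have hq := diff_has_der dq.
  apply: (proj1 (has_der_diff (has_der_near (nrm_gt0 z0) _ hq))).
  move=> w wz; rewrite /k ifF//; apply/negbTE/eqP => zw0.
  have := nrm0 (V := C); rewrite -zw0 => E.
  by have := nrm_sub_ge z (- w); rewrite opprK E nrmN; lra.
have ck : continuous k.
  move=> z; have [->|z0] := eqVneq z 0; last exact/differentiable_continuous/dk.
  apply: eps_continuous => e e0.
  have [d d0 dP] := hc _ e0; exists d => // w wd.
  rewrite add0r /k eqxx.
  have [w0|w0] := eqVneq w 0; first by rewrite subrr nrm0 ltW.
  have := dP _ wd; rewrite add0r => H.
  by rewrite -(ler_pM2r (nrm_gt0 w0)) -nrmM mulrBl divfK.
have E : avg (fun t => k (r%:C * cis t)) = c.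
  by rewrite avg_mean// /k eqxx.
have cc : continuous (fun t => h (r%:C * cis t) * cis (- t)).
  move=> t; apply: (@cvgM _ _ _ _ (fun t => h (r%:C * cis t)) (fun t => cis (- t))).
    exact: continuous_radius.
  exact: continuous_cisN.
have kE t : k (r%:C * cis t) =
    r^-1%:C * (h (r%:C * cis t) * cis (- t)) - r^-1%:C * h 0 * cis (- t).
  rewrite /k ifF; last by rewrite mulf_eq0 (negbTE (cis_neq0 t)) orbF; apply/negbTE;
    rewrite eq_complex /= eqxx andbT gt_eqF.
  rewrite invfM cisVJ fmorphV /=; ring.
have : avg (fun t => k (r%:C * cis t)) = r^-1%:C * avg (fun t => h (r%:C * cis t) * cis (- t)).
  have -> : (fun t => k (r%:C * cis t)) = (fun t => r^-1%:C * (h (r%:C * cis t) * cis (- t)) - r^-1%:C * h 0 * cis (- t)).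
    by apply/funext => t; exact: kE.
  have c1 : continuous (fun t => r^-1%:C * (h (r%:C * cis t) * cis (- t))).
    by move=> t; apply: cvgMr; exact: cc.
  have c2 : continuous (fun t => r^-1%:C * h 0 * cis (- t)).
    by move=> t; apply: cvgMr; exact: continuous_cisN.
  by rewrite (avgB c1 c2) (avgZ _ cc) (avgZ _ continuous_cisN) avg_cisN mulr0 subr0.
rewrite E => ->; rewrite mulrAC -rmorphM mulVf ?mul1r// gt_eqF//.
Qed.

End Average.

(** * Regularity of holomorphic functions on a normed module *)

Section Regularity.
Context {R : realType} {V : normedModType R[i]}.
Local Notation C := R[i].
Implicit Types (f g : V -> C) (x y z v w : V) (r M : R).

(** For row vectors this is [entire]; the general form covers in particular
    the restrictions of entire functions to complex lines. *)
Definition holo f := forall z, differentiable f z.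

Lemma holo_continuous f : holo f -> continuous f.
Proof. by move=> hf z; exact: differentiable_continuous. Qed.

Lemma holo_line f z w : holo f -> forall t, differentiable (fun s : C => f (z + s *: w)) t.
Proof. by move=> hf t; have [] := has_der_diff (has_der_line (hf (z + t *: w))). Qed.

Lemma continuous_circle f z w (r : R) : holo f -> continuous (fun t => f (z + (r%:C * cis t) *: w)).
Proof.
move=> hf; have h1 := holo_line z w hf.
apply: (@continuous_radius _ (fun s : C => f (z + s *: w))) => s.
exact: differentiable_continuous.
Qed.

Lemma continuous_circle_cis f z w (r : R) : holo f ->
  continuous (fun t => f (z + (r%:C * cis t) *: w) * cis (- t)).
Proof.
move=> hf t; apply: (@cvgM _ _ _ _ (fun t => f (z + (r%:C * cis t) *: w)) (fun t => cis (- t))).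
  exact: continuous_circle.
exact: continuous_cisN.
Qed.

Lemma diff_avg f z w r : holo f -> 0 < r ->
  'd f z w = r^-1%:C * avg (fun t => f (z + (r%:C * cis t) *: w) * cis (- t)).
Proof.
move=> hf r0.
have hd : has_der (fun s => f (z + s *: w)) 0 ('d f z w).
  by have := @has_der_line _ _ f z w 0; rewrite scale0r addr0; apply.
rewrite (cauchy_derivative (holo_line z w hf) hd r0) mulrCA -rmorphM mulVf ?mulr1//.
by rewrite gt_eqF.
Qed.

(** Cauchy's estimate on the line through [z] in the direction [w]. *)
Lemma diff_bound f z w r M : holo f -> 0 < r ->
  (forall u : C, nrm u = r -> nrm (f (z + u *: w)) <= M) -> nrm ('d f z w) <= M / r.
Proof.
move=> hf r0 fM; rewrite (diff_avg z w hf r0) nrmM nrm_real ger0_norm ?invr_ge0 ?(ltW r0)//.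
rewrite mulrC ler_wpM2r ?invr_ge0 ?(ltW r0)//.
apply: avg_bound; first exact: continuous_circle_cis.
by move=> t; rewrite nrmM nrm_cis mulr1 fM// nrmM nrm_cis mulr1 nrm_real gtr0_norm.
Qed.

Lemma diff_bound_ball f z w r M : holo f -> 0 < r ->
  (forall y, nrm (y - z) <= r -> nrm (f y) <= M) -> nrm ('d f z w) <= M / r * nrm w.
Proof.
move=> hf r0 fM; have [->|w0] := eqVneq w 0.
  by rewrite linear0 !nrm0 mulr0.
have nw := nrm_gt0 w0.
have -> : M / r * nrm w = M / (r / nrm w) by rewrite invfM invrK mulrA.
apply: diff_bound => //; first by rewrite divr_gt0.
move=> u uE; apply: fM; rewrite addrC addKr nrmZ uE divfK ?gt_eqF//.
Qed.

Lemma convex_combE (s : R) x y : x + s%:C *: (y - x) = (1 - s)%:C *: x + s%:C *: y.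
Proof. by rewrite rmorphB scalerBl scale1r -addrA [- _ + _]addrC -scalerBr. Qed.

Lemma nrm_convex (s : R) x y r : 0 <= s <= 1 -> nrm x <= r -> nrm y <= r ->
  nrm (x + s%:C *: (y - x)) <= r.
Proof.
move=> /andP[s0 s1] xr yr; rewrite convex_combE.
apply: le_trans (nrmD _ _) _; rewrite !nrmZ !nrm_real !ger0_norm//; last by lra.
have : (1 - s) * nrm x <= (1 - s) * r by rewrite ler_wpM2l//; lra.
have : s * nrm y <= s * r by rewrite ler_wpM2l.
lra.
Qed.

Lemma lipschitz_ball f z x y r M : holo f -> 0 < r ->
  (forall u, nrm (u - z) <= 2 * r -> nrm (f u) <= M) ->
  nrm (x - z) <= r -> nrm (y - z) <= r ->
  nrm (f y - f x) <= M / r * nrm (y - x).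
Proof.
move=> hf r0 fM xr yr; pose w := y - x.
have mid (s : R) : 0 <= s <= 1 -> nrm (x + s%:C *: w - z) <= r.
  move=> s01; have := nrm_convex s01 xr yr.
  by rewrite opprB [y - z + _]addrA subrK addrAC.
have := @mvt_le _ (fun s => f (x + s%:C *: w)) (fun s => (M / r * nrm w)%:C * s%:C)
  (fun s => 'd f (x + s%:C *: w) w) (fun=> (M / r * nrm w)%:C) 0 1 ler01.
rewrite /= scale1r scale0r addr0 /w [x + _]addrC subrK.
rewrite /= !mulr0 mulr1 !subr0; apply.
- move=> s _; apply: (@has_der_rder _ (fun s => f (x + s *: w))).
  exact: has_der_line.
- by move=> s _; exact: rder_id.
- move=> s /mid ms; apply: diff_bound_ball => // u ur; apply: fM.
  rewrite -(subrK (x + s%:C *: w) u) -addrA; apply: le_trans (nrmD _ _) _.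
  by lra.
Qed.

(** The differential is a circle mean of [f], and [f] is Lipschitz by
    Cauchy's estimate. *)
Lemma diff_lipschitz f z x y w r M : holo f -> 0 < r ->
  (forall u, nrm (u - z) <= 8 * r -> nrm (f u) <= M) ->
  nrm (x - z) <= r -> nrm (y - z) <= r ->
  nrm ('d f y w - 'd f x w) <= M / (r ^+ 2) * nrm (y - x) * nrm w.
Proof.
move=> hf r0 fM xr yr.
have M0 : 0 <= M by apply: le_trans (nrm_ge0 (f z)) (fM z _); rewrite subrr nrm0; lra.
have [->|w0] := eqVneq w 0;
  first by rewrite (linear0 ('d f y)) (linear0 ('d f x)) subr0 !nrm0 mulr0.
have nw := nrm_gt0 w0.
(* With this radius the circle in the direction [w] has radius [r] in [V]. *)
pose q := r / nrm w; have q0 : 0 < q by rewrite divr_gt0.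
have cx := continuous_circle_cis (z := x) (w := w) (r := q) hf.
have cy := continuous_circle_cis (z := y) (w := w) (r := q) hf.
rewrite (diff_avg y w hf q0) (diff_avg x w hf q0) -mulrBr -(avgB cy cx).
rewrite nrmM nrm_real gtr0_norm ?invr_gt0//.
set B := M / r ^+ 2 * nrm (y - x).
have B0 : 0 <= B by rewrite mulr_ge0 ?nrm_ge0// divr_ge0// exprn_ge0// ltW.
have qE : q^-1 * (r * B) = B * nrm w.
  by rewrite /q invfM invrK; field; rewrite gt_eqF.
rewrite -qE ler_wpM2l ?invr_ge0 ?(ltW q0)//.
apply: avg_bound.
  by move=> t; apply: cvgB; [exact: cy|exact: cx].
move=> t; rewrite -mulrBl nrmM nrm_cis mulr1.
set c := (_ *: w); have nc : nrm c = r.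
  by rewrite /c nrmZ nrmM nrm_cis mulr1 nrm_real gtr0_norm// /q divfK// gt_eqF.
have r4 : 0 < 4 * r by rewrite mulr_gt0.
have := @lipschitz_ball f z (x + c) (y + c) (4 * r) M hf r4.
have -> : y + c - (x + c) = y - x by rewrite opprD addrACA subrr addr0.
move=> /(_ _ _ _)/le_trans; apply.
- by move=> u; rewrite mulrA => uz; apply: fM; lra.
- by rewrite addrAC; apply: le_trans (nrmD _ _) _; rewrite nc; lra.
- by rewrite addrAC; apply: le_trans (nrmD _ _) _; rewrite nc; lra.
have -> : M / (4 * r) * nrm (y - x) = (r * B) / 4 by rewrite /B; field; rewrite gt_eqF.
have : 0 <= r * B by rewrite mulr_ge0// ltW.
lra.
Qed.

(** Integrates [diff_lipschitz] along the segment; what matters is that the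
    constant is uniform in the base point [x]. *)
Lemma taylor2 f z x w r M : holo f -> 0 < r ->
  (forall u, nrm (u - z) <= 8 * r -> nrm (f u) <= M) ->
  nrm (x - z) <= r -> nrm (x + w - z) <= r ->
  nrm (f (x + w) - f x - 'd f x w) <= M / (r ^+ 2) * nrm w ^+ 2.
Proof.
move=> hf r0 fM xr yr.
have mid (s : R) : 0 <= s <= 1 -> nrm (x + s%:C *: w - z) <= r.
  move=> s01; have := nrm_convex s01 xr yr.
  by rewrite opprB [x + w - z + _]addrA subrK [x + w - x]addrAC subrr add0r addrAC.
pose K := M / (r ^+ 2) * nrm w ^+ 2.
have := @mvt_le _ (fun s => 1 * f (x + s%:C *: w) + (-1) * ('d f x w * s%:C)) (fun s => K%:C * s%:C)
  (fun s => 1 * 'd f (x + s%:C *: w) w + (-1) * 'd f x w) (fun=> K%:C) 0 1 ler01.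
rewrite /= !scale1r scale0r addr0 !mulr0 !mul1r !addr0 !mulN1r !mulr1 !subr0.
rewrite [f (x + w) - _ - _]addrAC; apply.
- move=> s _; rewrite -[- 'd f x w]mulN1r; apply: rder_lin; last exact: rder_id.
  by apply: (@has_der_rder _ (fun s => f (x + s *: w))); exact: has_der_line.
- by move=> s _; exact: rder_id.
- move=> s s01; have ms := mid s s01; rewrite mul1r.
  apply: le_trans (diff_lipschitz w hf r0 fM xr ms) _.
  rewrite [x + _ - x]addrAC subrr add0r nrmZ nrm_real.
  move: s01 => /andP[s0 s1]; rewrite ger0_norm// /K expr2 -!mulrA.
  have M0 : 0 <= M by apply: le_trans (nrm_ge0 (f z)) (fM z _); rewrite subrr nrm0; lra.
  rewrite ler_wpM2l// ler_wpM2l ?invr_ge0 ?mulr_ge0 ?(ltW r0)//.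
  by rewrite ler_piMl// mulr_ge0 ?nrm_ge0.
Qed.

Lemma locally_bounded f z : holo f ->
  exists2 r : R, 0 < r & exists M : R, forall u, nrm (u - z) <= r -> nrm (f u) <= M.
Proof.
move=> hf; have cf : {for z, continuous f} by exact: holo_continuous.
have [d d0 dP] := continuous_eps cf ltr01.
exists (d / 2); first by rewrite divr_gt0.
exists (nrm (f z) + 1) => u uz.
have uz' : nrm (u - z) < d by lra.
have := dP _ uz'; rewrite [z + _]addrC subrK => h.
by rewrite -(subrK (f z) (f u)); apply: le_trans (nrmD _ _) _; lra.
Qed.

Lemma continuous_diff f w : holo f -> continuous (fun y => 'd f y w).
Proof.
move=> hf z; have [r8 r80 [M fM]] := locally_bounded z hf.
pose r := r8 / 8; have r0 : 0 < r by rewrite divr_gt0.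
have fM' u : nrm (u - z) <= 8 * r -> nrm (f u) <= M.
  by move=> h; apply: fM; move: h; rewrite /r; lra.
have M0 : 0 <= M by apply: le_trans (nrm_ge0 (f z)) (fM z _); rewrite subrr nrm0 ltW.
pose K := M / r ^+ 2 * nrm w.
have K0 : 0 <= K by rewrite mulr_ge0 ?nrm_ge0// divr_ge0// exprn_ge0// ltW.
apply: eps_continuous => e e0.
exists (Num.min r (e / (K + 1))); first by rewrite lt_min r0 divr_gt0// ltr_wpDl.
move=> y; rewrite lt_min => /andP[yr]; rewrite ltr_pdivlMr ?ltr_wpDl// => yK.
have := @diff_lipschitz f z z (z + y) w r M hf r0 fM'.
rewrite subrr nrm0 [z + y - z]addrAC subrr add0r => /(_ (ltW r0) (ltW yr)) /le_trans; apply.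
rewrite mulrAC -/K; apply: le_trans (ltW yK).
by rewrite mulrC ler_wpM2l ?nrm_ge0// lerDl.
Qed.

(** Cauchy's formula expresses ['d f z v] as a circle mean of [f]. The
    candidate differential [L] is the same mean of the differentials of [f],
    and [taylor2] bounds the remainder uniformly on the circle. *)
Lemma holo_diff f v : holo f -> holo (fun z => 'd f z v).
Proof.
move=> hf z; have [->|v0] := eqVneq v 0.
  have -> : (fun z => 'd f z 0) = cst 0 by apply/funext => y; rewrite linear0.
  exact: differentiable_cst.
have [r8 r80 [M fM]] := locally_bounded z hf.
pose r := r8 / 8; have r0 : 0 < r by rewrite divr_gt0.
have fM' u : nrm (u - z) <= 8 * r -> nrm (f u) <= M.
  by move=> h; apply: fM; move: h; rewrite /r; lra.
have nv := nrm_gt0 v0.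
(* With this radius the circle in the direction [v] has radius [r / 2] in [V],
   which leaves room for an increment of size [r / 2]. *)
pose q := r / 2 / nrm v; have q0 : 0 < q by rewrite !divr_gt0.
pose p t := z + (q%:C * cis t) *: v.
have pz t : nrm (p t - z) = r / 2.
  rewrite /p addrC addKr nrmZ nrmM nrm_cis mulr1 nrm_real gtr0_norm//.
  by rewrite divfK// gt_eqF.
have M0 : 0 <= M by apply: le_trans (nrm_ge0 (f z)) (fM z _); rewrite subrr nrm0 ltW.
have Mr0 : 0 <= M / r ^+ 2 by rewrite divr_ge0// exprn_ge0// ltW.
have cp w : continuous (fun t => 'd f (p t) w).
  have cs : continuous (fun s : C => 'd f (z + s *: v) w).
    move=> s; apply: (@continuous_comp _ _ _ (fun s : C => z + s *: v) (fun y => 'd f y w)).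
      apply: eps_continuous => e e0; exists (e / nrm v); first by rewrite divr_gt0.
      move=> s'; rewrite ltr_pdivlMr// => s'v.
      by rewrite scalerDl opprD addrACA subrr add0r addrAC subrr add0r nrmZ ltW.
    exact: continuous_diff.
  by apply: (@continuous_radius _ (fun s : C => 'd f (z + s *: v) w)).
have ccp w : continuous (fun t => 'd f (p t) w * cis (- t)).
  move=> t; apply: (@cvgM _ _ _ _ (fun t => 'd f (p t) w) (fun t => cis (- t))).
    exact: cp.
  exact: continuous_cisN.
pose L w := q^-1%:C * avg (fun t => 'd f (p t) w * cis (- t)).
have linL : linear L.
  move=> a x y; rewrite /L.
  have -> : (fun t => 'd f (p t) (a *: x + y) * cis (- t)) =
     (fun t => a * ('d f (p t) x * cis (- t)) + 'd f (p t) y * cis (- t)).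
    apply/funext => t; rewrite linearD linearZ /= -[_ *: 'd _ _ _]/(_ * _); ring.
  rewrite avgD ?avgZ//; first by rewrite mulrDr mulrCA.
  by move=> t; apply: cvgMr; exact: ccp.
pose LL' := GRing.isLinear.Build _ _ _ _ L linL.
pose LL : {linear V -> C} := HB.pack L LL'.
have Lbnd w : nrm (L w) <= q^-1 * (M / r) * nrm w.
  rewrite /L nrmM nrm_real ger0_norm ?invr_ge0 ?(ltW q0)// -mulrA.
  apply: ler_wpM2l; first by rewrite invr_ge0 ltW.
  apply: avg_bound => // t; rewrite nrmM nrm_cis mulr1.
  apply: diff_bound_ball => // y yr; apply: fM'.
  by rewrite -(subrK (p t) y) -addrA; apply: le_trans (nrmD _ _) _; rewrite pz; lra.
have cL : continuous LL.
  move=> x; apply: eps_continuous => e e0; pose K := q^-1 * (M / r).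
  have K0 : 0 <= K by rewrite mulr_ge0 ?invr_ge0 ?divr_ge0// ltW.
  exists (e / (K + 1)); first by rewrite divr_gt0// ltr_wpDl.
  move=> w; rewrite ltr_pdivlMr ?ltr_wpDl// => wK.
  rewrite linearD addrAC subrr add0r; apply: le_trans (Lbnd w) _; rewrite -/K.
  by apply: le_trans (ltW wK); rewrite mulrC ler_wpM2l ?nrm_ge0// lerDl.
suff H (e : R) : 0 < e -> exists2 d : R, 0 < d &
    forall w, nrm w < d -> nrm ('d f (z + w) v - 'd f z v - LL w) <= e * nrm w.
  by have [] := @eps_diff _ _ _ (fun z => 'd f z v) z LL cL H.
move=> e0; pose K := q^-1 * (M / r ^+ 2).
have K0 : 0 <= K by rewrite mulr_ge0// invr_ge0 ltW.
exists (Num.min (r / 2) (e / (K + 1))).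
  by rewrite lt_min !divr_gt0// ltr_wpDl.
move=> w; rewrite lt_min => /andP[wr]; rewrite ltr_pdivlMr ?ltr_wpDl// => wK.
have -> : 'd f (z + w) v - 'd f z v - LL w =
   q^-1%:C * avg (fun t => (f (p t + w) - f (p t) - 'd f (p t) w) * cis (- t)).
  rewrite (diff_avg (z + w) v hf q0) (diff_avg z v hf q0) -[LL w]/(L w) /L -mulrBr -mulrBr.
  have cA := continuous_circle_cis (z := z + w) (w := v) (r := q) hf.
  have cB := continuous_circle_cis (z := z) (w := v) (r := q) hf.
  rewrite -(avgB cA cB) -(avgB _ (ccp w)).
    congr (_ * avg _); apply/funext => t; rewrite /p [z + _ + w]addrAC; ring.
  by move=> t; apply: cvgB; [exact: cA|exact: cB].
rewrite nrmM nrm_real ger0_norm ?invr_ge0 ?(ltW q0)//.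
have cB2 : continuous (fun t => f (p t)) by exact: continuous_circle.
have cA2 : continuous (fun t => f (p t + w)).
  have -> : (fun t => f (p t + w)) = (fun t => f ((z + w) + (q%:C * cis t) *: v)).
    by apply/funext => t; rewrite /p addrAC.
  exact: continuous_circle.
have bnd : nrm (avg (fun t => (f (p t + w) - f (p t) - 'd f (p t) w) * cis (- t))) <= M / r ^+ 2 * nrm w ^+ 2.
  apply: avg_bound.
    move=> t;
      apply: (@cvgM _ _ _ _ (fun t => f (p t + w) - f (p t) - 'd f (p t) w) (fun t => cis (- t))); last exact: continuous_cisN.
    apply: cvgB; last exact: cp.
    by apply: cvgB; [exact: cA2|exact: cB2].
  move=> t; rewrite nrmM nrm_cis mulr1; apply: (taylor2 hf r0 fM').
    by rewrite pz; lra.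
  by rewrite addrAC; apply: le_trans (nrmD _ _) _; rewrite pz; lra.
apply: le_trans (ler_wpM2l _ bnd) _; first by rewrite invr_ge0 ltW.
rewrite expr2 mulrA -/K mulrA ler_wpM2r ?nrm_ge0//.
by apply: le_trans (ltW wK); rewrite mulrC ler_wpM2l ?nrm_ge0// lerDl.
Qed.

End Regularity.

(** * Compactness of closed balls *)

Section Compactness.
Context {R : realType}.
Local Notation C := R[i].

(** The only trace of finite dimension in the analytic part of the proof. *)
Definition compact_balls (V : normedModType R[i]) :=
  forall (z : V) (r : R), compact [set y : V | nrm (y - z) <= r].

Lemma continuous_nrm (V : normedModType R[i]) (g : V -> C) (z : V) :
  {for z, continuous g} -> {for z, continuous (fun y => nrm (g y))}.
Proof.
move=> gz; apply/(@cvgrPdist_le _ _ _ (nbhs z)) => e e0.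
have [d d0 dP] := continuous_eps gz e0.
apply/nrm_nbhs; exists d => // w /dP h.
have := nrm_sub_ge (g (z + w)) (g z); have := nrm_sub_ge (g z) (g (z + w)).
by rewrite nrm_distC ler_norml; lra.
Qed.

Lemma ball_closed (V : normedModType R[i]) (z : V) (r : R) :
  closed [set y : V | nrm (y - z) <= r].
Proof.
move=> y yc /=; apply/ler_addgt0Pl => e e0.
have [|x [/= xz]] := yc [set x | nrm (x - y) <= e].
  by apply/nrm_nbhs; exists e => // w we /=; rewrite addrC addKr ltW.
rewrite /= => xy; have {xy} : nrm (y - x) <= e by rewrite nrm_distC.
move=> xy.
have -> : y - z = (y - x) + (x - z) by rewrite addrA subrK.
by apply: le_trans (nrmD _ _) _; apply: lerD.
Qed.

Lemma compact_square (r : R) :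
  compact [set z : C | `|complex.Re z| <= r /\ `|complex.Im z| <= r].
Proof.
pose f (p : R * R) : C := p.1 +i* p.2.
have cf : continuous f.
  move=> p; apply/cvgrPdist_le => e e0.
  have eE : e = (complex.Re e)%:C by rewrite RRe_real// gtr0_real.
  have e0' : 0 < complex.Re e / 2 by rewrite divr_gt0// -ltcR -eE.
  have /cvgrPdist_le /(_ _ e0') h1 : @fst R R x @[x --> p] --> p.1 by exact: cvg_fst.
  have /cvgrPdist_le /(_ _ e0') h2 : @snd R R x @[x --> p] --> p.2 by exact: cvg_snd.
  near=> q; rewrite nrmE eE lecR (splitr (complex.Re e)).
  apply: le_trans (nrm_le_ReIm _) _; apply: lerD => /=.
    by near: q.
  by near: q.
have -> : [set z : C | `|complex.Re z| <= r /\ `|complex.Im z| <= r] =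
   f @` (`[- r, r] `*` `[- r, r]).
  apply/seteqP; split=> [[x y] /= [xr yr]|_ [[x y] /= [xr yr] <-]].
    by exists (x, y) => //=; rewrite !in_itv /= -!ler_norml.
  by move: xr yr; rewrite !in_itv /= -!ler_norml.
apply: continuous_compact; first exact: continuous_subspaceT.
by apply: compact_setX; exact: segment_compact.
Unshelve. all: by end_near. Qed.

Lemma compact_balls_C : compact_balls C.
Proof.
move=> z r.
apply: (subclosed_compact (@ball_closed _ z r) (@compact_square (r + nrm z))).
move=> y /= yz; have yr : nrm y <= r + nrm z.
  by rewrite -(subrK z y); apply: le_trans (nrmD _ _) _; rewrite lerD2r.
by split; apply: le_trans yr; [exact: absRe_le_nrm|exact: absIm_le_nrm].
Qed.

Lemma nrm_coord n (v : 'rV[C]_n) i : nrm (v ord0 i) <= nrm v.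
Proof.
apply/ler_addgt0Pr => e e0.
have ve : ball (0 : 'rV[C]_n) (nrm v + e)%:C v.
  by rewrite -ball_normE /ball_ /= sub0r normrN nrmE ltcR ltrDl.
have [_ /(_ ord0 i)] := ve.
by rewrite -ball_normE /ball_ /= mxE sub0r normrN nrmE ltcR => /ltW.
Qed.

Lemma compact_balls_rV n : compact_balls 'rV[C]_n.
Proof.
move=> z r.
have cS := rV_compact (fun _ : 'I_n => @compact_square (r + nrm z)).
apply: (subclosed_compact (@ball_closed _ z r) cS).
move=> y /= yz i; have yr : nrm (y ord0 i) <= r + nrm z.
  apply: le_trans (nrm_coord _ _) _.
  by rewrite -(subrK z y); apply: le_trans (nrmD _ _) _; rewrite lerD2r.
by split; apply: le_trans yr; [exact: absRe_le_nrm|exact: absIm_le_nrm].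
Qed.

Lemma holo_max (V : normedModType R[i]) (f : V -> C) z (r : R) :
  compact_balls V -> continuous f -> 0 <= r ->
  exists2 y, nrm (y - z) <= r & forall x, nrm (x - z) <= r -> nrm (f x) <= nrm (f y).
Proof.
move=> cV cf r0.
have [|//|y yA ymax] := @compact_EVT_max V R (fun x => nrm (f x)) _ _ (cV z r).
- by exists z; rewrite /= subrr nrm0.
- by apply: continuous_subspaceT => x; apply: continuous_nrm; exact: cf.
exists y; first by move: yA; rewrite inE.
by move=> x xz; apply: ymax; rewrite inE.
Qed.

End Compactness.

(** * Logarithms of zero-free functions of one variable *)

Section Logarithm.
Context {R : realType}.
Local Notation C := R[i].
Implicit Types (h k psi phi : C -> C) (z w t c : C).

Lemma diff_mul1 h z w : 'd h z w = w * 'd h z 1.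
Proof. by rewrite -[in LHS](mulr1 w) -[w * 1]/(w *: (1 : C)) linearZ. Qed.

Lemma has_derM h k z c c' : has_der h z c -> has_der k z c' ->
  has_der (fun s => h s * k s) z (c * k z + h z * c').
Proof.
move=> /has_der_diff[dh Eh] /has_der_diff[dk Ek].
have dhk : differentiable (h * k) z by exact: (differentiableM dh dk).
have eh : 'd h z 1 = c * 1 := congr1 (@^~ 1) Eh.
have ek : 'd k z 1 = c' * 1 := congr1 (@^~ 1) Ek.
have E : 'd (h * k) z 1 = c * k z + h z * c'.
  rewrite (diffM dh dk); transitivity (h z * 'd k z 1 + k z * 'd h z 1) => //.
  transitivity (h z * (c' * 1) + k z * (c * 1)); last by ring.
  by congr (_ * _ + _ * _); [exact: ek|exact: eh].
by have := diff_has_der dhk; rewrite E.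
Qed.

Lemma has_der_comp h k z c c' : has_der h z c -> has_der k (h z) c' ->
  has_der (fun s => k (h s)) z (c' * c).
Proof.
move=> /has_der_diff[dh Eh] /has_der_diff[dk Ek].
have dhk : differentiable (k \o h) z by exact: (differentiable_comp dh dk).
have eh : 'd h z 1 = c * 1 := congr1 (@^~ 1) Eh.
have E : 'd (k \o h) z 1 = c' * c.
  rewrite (diff_comp dh dk); transitivity ('d k (h z) ('d h z 1)) => //.
  transitivity ('d k (h z) (c * 1)); first exact: (congr1 ('d k (h z)) eh).
  transitivity (c' * (c * 1)); first exact: (congr1 (@^~ (c * 1)) Ek).
  by rewrite mulr1.
by have := diff_has_der dhk; rewrite E.
Qed.

Lemma has_der_cst c z : has_der (fun=> c) z 0.
Proof.
move=> e e0; exists 1 => // w _; rewrite subrr sub0r mul0r oppr0 nrm0.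
by rewrite mulr_ge0 ?nrm_ge0// ltW.
Qed.

Lemma has_der_id z : has_der (fun s => s) z 1.
Proof.
move=> e e0; exists 1 => // w _; rewrite [z + w - z]addrAC subrr add0r mul1r subrr nrm0.
by rewrite mulr_ge0 ?nrm_ge0// ltW.
Qed.

Lemma has_derN h z c : has_der h z c -> has_der (fun s => - h s) z (- c).
Proof.
move=> hc; have := has_derM (has_der_cst (-1) z) hc.
rewrite mul0r add0r mulN1r.
by have -> : (fun s => -1 * h s) = (fun s => - h s) by apply/funext => s; rewrite mulN1r.
Qed.

Lemma has_der_const h : (forall z, has_der h z 0) -> forall z, h z = h 0.
Proof.
move=> h0 z; apply/eqP; rewrite -subr_eq0; apply/eqP/nrm_eq0/eqP.
rewrite eq_le nrm_ge0 andbT.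
have := @mvt_le _ (fun s => h (s%:C * z)) (fun=> 0) (fun=> 0) (fun=> 0) 0 1 ler01.
rewrite /= mul1r mul0r subrr; apply => x _; last by rewrite nrm0.
- apply: (@has_der_rder _ (fun s => h (s * z))).
  have := has_der_comp (has_derM (has_der_id x%:C) (has_der_cst z x%:C)) (h0 _).
  by rewrite mul0r.
- exact: rder_cst.
Qed.

(** The primitive is the integral along rays from the origin. It is
    differentiated under the integral, the remainder being bounded by [taylor2]
    uniformly along the ray. *)
Lemma primitive psi : holo psi ->
  exists g : C -> C, g 0 = 0 /\ forall t, has_der g t (psi t).
Proof.
move=> hpsi; pose psi' t := 'd psi t 1.
have hpsi' : holo psi' by exact: holo_diff.
have cpsi : continuous psi := holo_continuous hpsi.
have cpsi' : continuous psi' := holo_continuous hpsi'.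
pose g t := t * cint 0 1 (fun s => psi (s%:C * t)).
have cray (k : C -> C) t : continuous k -> continuous (fun s : R => k (s%:C * t)).
  move=> ck s; apply: (@continuous_comp _ _ _ (fun s : R => s%:C * t) k); last exact: ck.
  apply: cvgMl.
  by apply: (continuous_ReIm (u := id) (v := cst 0)) => ?; [exact: cvg_id|exact: cst_continuous].
have cup : continuous (fun u : C => u * psi' u).
  by move=> u; exact: (has_der_continuous (has_derM (has_der_id u) (diff_has_der (hpsi' u)))).
exists g; split; first by rewrite /g mul0r.
move=> t e e0.
pose r := nrm t + 1; have r0 : 0 < r by rewrite ltr_wpDl ?nrm_ge0.
have r80 : 0 <= 8 * r by rewrite mulr_ge0// ltW.
have [b _ bP] := holo_max (f := psi) 0 (compact_balls_C (R := R)) cpsi r80.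
pose M := nrm (psi b).
have fM u : nrm (u - 0) <= 8 * r -> nrm (psi u) <= M by exact: bP.
pose K := M / r ^+ 2; pose K' := M / (4 * r).
have K0 : 0 <= K by rewrite divr_ge0 ?nrm_ge0// exprn_ge0// ltW.
have K'0 : 0 <= K' by rewrite divr_ge0 ?nrm_ge0// mulr_ge0// ltW.
pose D := nrm t * K + K'.
have D0 : 0 <= D by rewrite addr_ge0// mulr_ge0 ?nrm_ge0.
exists (Num.min 1 (e / (D + 1))); first by rewrite lt_min ltr01 divr_gt0// ltr_wpDl.
move=> w; rewrite lt_min => /andP[w1]; rewrite ltr_pdivlMr ?ltr_wpDl// => wD.
have psiE : psi t = cint 0 1 (fun s => psi (s%:C * t) + s%:C * t * psi' (s%:C * t)).
  rewrite (@cintE _ _ _ _ (fun s => s%:C * psi (s%:C * t)) ler01).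
  - by rewrite mul0r subr0 !mul1r.
  - move=> s; apply: cvgD; first exact: cray.
    exact: (cray _ t cup s).
  - move=> s _; apply: (@has_der_rder _ (fun z => z * psi (z * t))).
    have h1 : has_der (fun z => psi (z * t)) s%:C (psi' (s%:C * t) * (1 * t + s%:C * 0)).
      apply: (@has_der_comp (fun z => z * t) psi).
        exact: (has_derM (has_der_id _) (has_der_cst _ _)).
      exact: diff_has_der.
    have := has_derM (has_der_id s%:C) h1.
    suff -> : psi (s%:C * t) + s%:C * t * psi' (s%:C * t) =
      1 * psi (s%:C * t) + s%:C * (psi' (s%:C * t) * (1 * t + s%:C * 0)) by [].
    by ring.
have cA : continuous (fun s : R => psi (s%:C * (t + w))) by exact: cray.
have cB : continuous (fun s : R => psi (s%:C * t)) by exact: cray.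
have cD : continuous (fun s : R => psi (s%:C * t) + s%:C * t * psi' (s%:C * t)).
  move=> s; apply: cvgD; first exact: cray.
  exact: (cray _ t cup s).
have ctA : continuous (fun s : R => (t + w) * psi (s%:C * (t + w))) by move=> s; apply: cvgMr;
  exact: cA.
have ctB : continuous (fun s : R => t * psi (s%:C * t)) by move=> s; apply: cvgMr; exact: cB.
have cwD : continuous (fun s : R => w * (psi (s%:C * t) + s%:C * t * psi' (s%:C * t))) by move=> s;
  apply: cvgMr; exact: cD.
have cAB : continuous (fun s : R => (t + w) * psi (s%:C * (t + w)) - t * psi (s%:C * t)).
  by move=> s; apply: cvgB; [exact: ctA|exact: ctB].
have -> : g (t + w) - g t - psi t * w = cint 0 1 (fun s =>
   (t + w) * psi (s%:C * (t + w)) - t * psi (s%:C * t) -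
   w * (psi (s%:C * t) + s%:C * t * psi' (s%:C * t))).
  rewrite (cintB ler01 cAB cwD) (cintB ler01 ctA ctB) (cintZ _ ler01 cA).
  by rewrite (cintZ _ ler01 cB) (cintZ _ ler01 cD) -psiE /g; ring.
have c0 : continuous (fun s : R => (t + w) * psi (s%:C * (t + w)) - t * psi (s%:C * t) -
   w * (psi (s%:C * t) + s%:C * t * psi' (s%:C * t))).
  by move=> s; apply: cvgB; [exact: cAB|exact: cwD].
have bnd : nrm (cint 0 1 (fun s =>
   (t + w) * psi (s%:C * (t + w)) - t * psi (s%:C * t) -
   w * (psi (s%:C * t) + s%:C * t * psi' (s%:C * t)))) <= D * nrm w ^+ 2 * (1 - 0).
  apply: (cint_bound ler01 c0) => s /andP[s0 s1].
  have nsz u : nrm (s%:C * u) = s * nrm u by rewrite nrmM nrm_real ger0_norm.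
  have sw : nrm (s%:C * w) <= nrm w by rewrite nsz ler_piMl ?nrm_ge0.
  have st : nrm (s%:C * t) <= nrm t by rewrite nsz ler_piMl ?nrm_ge0.
  have x1 : nrm (s%:C * t - 0) <= r by rewrite subr0 /r; lra.
  have x2 : nrm (s%:C * t + s%:C * w - 0) <= r.
    by rewrite subr0; apply: le_trans (nrmD _ _) _; rewrite /r; lra.
  have T := taylor2 hpsi r0 fM x1 x2.
  have r4 : 0 < 4 * r by rewrite mulr_gt0.
  have L : nrm (psi (s%:C * t + s%:C * w) - psi (s%:C * t)) <= K' * nrm w.
    have := @lipschitz_ball _ _ psi 0 (s%:C * t) (s%:C * t + s%:C * w) (4 * r) M hpsi r4.
    rewrite [_ + _ - s%:C * t]addrAC subrr add0r => /(_ _ _ _)/le_trans; apply.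
    - by move=> u; rewrite mulrA => uz; apply: fM; lra.
    - by lra.
    - by lra.
    by rewrite ler_wpM2l.
  have dE : 'd psi (s%:C * t) (s%:C * w) = s%:C * w * psi' (s%:C * t).
    exact: diff_mul1.
  rewrite dE in T.
  have -> : (t + w) * psi (s%:C * (t + w)) - t * psi (s%:C * t) -
     w * (psi (s%:C * t) + s%:C * t * psi' (s%:C * t)) =
     t * (psi (s%:C * t + s%:C * w) - psi (s%:C * t) - s%:C * w * psi' (s%:C * t)) +
     w * (psi (s%:C * t + s%:C * w) - psi (s%:C * t)) by rewrite mulrDr; ring.
  apply: le_trans (nrmD _ _) _; rewrite !nrmM /D mulrDl; apply: lerD.
    rewrite -[leRHS]mulrA ler_wpM2l ?nrm_ge0//; apply: le_trans T _.
    by rewrite ler_wpM2l// ler_sqr ?nnegrE ?nrm_ge0.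
  by rewrite expr2 mulrA mulrC ler_wpM2r ?nrm_ge0.
apply: le_trans bnd _; rewrite subr0 mulr1 expr2 mulrA ler_wpM2r ?nrm_ge0//.
by apply: le_trans (ltW wD); rewrite mulrC ler_wpM2l ?nrm_ge0// lerDl.
Qed.

(** If [g] is a primitive of the logarithmic derivative, then
    [phi * cexp (- g)] has derivative 0. *)
Lemma logarithm phi : holo phi -> (forall t, phi t != 0) ->
  exists g : C -> C, [/\ g 0 = 0, forall t, has_der g t ('d phi t 1 / phi t) &
    forall t, nrm (phi t) = nrm (phi 0) * expR (complex.Re (g t))].
Proof.
move=> hphi phi0.
have hpsi : holo (fun t => 'd phi t 1 / phi t).
  move=> t; apply: differentiableM; first exact: holo_diff.
  exact: differentiableV.
have [g [g0 dg]] := primitive hpsi.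
exists g; split=> // t.
have der0 s : has_der (fun s => phi s * cexp (- g s)) s 0.
  have := has_derM (diff_has_der (hphi s)) (has_der_comp (has_derN (dg s)) (has_der_cexp _)).
  suff -> : 'd phi s 1 * cexp (- g s) + phi s * (cexp (- g s) * - ('d phi s 1 / phi s)) = 0 by [].
  by field; exact: phi0.
have := has_der_const der0 t; rewrite g0 oppr0 => /(congr1 nrm).
rewrite (nrmM (phi t)) (nrmM (phi 0)) !nrm_cexp raddfN /= expR0 mulr1 => <-.
by rewrite -mulrA -expRD addrC subrr expR0 mulr1.
Qed.

End Logarithm.

(** * Gradient estimate and Harnack inequality for zero-free functions *)

Section ZeroFree.
Context {R : realType}.
Local Notation C := R[i].

Lemma Re_add_conj (z : C) : z + z^* = (2 * complex.Re z)%:C.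
Proof. by case: z => a b; apply/eqP; rewrite eq_complex /= subrr eqxx andbT; apply/eqP; ring. Qed.

(** Let [g] be the logarithm of [phi / phi 0], and [G] its restriction to the
    circle of radius [r]. As the conjugate of [G] is orthogonal to [cis], the
    function [G] may be replaced with [2 * Re G] in Cauchy's formula for the
    derivative of [g], and then with [2 * Re G - 2 * A], which is at most 0 and
    has mean [- 2 * A]. *)
Lemma gradient_C (phi : C -> C) (r A : R) : holo phi -> (forall t, phi t != 0) -> 0 < r ->
  (forall t, nrm t = r -> nrm (phi t) <= nrm (phi 0) * expR A) ->
  nrm ('d phi 0 1) <= 2 * A / r * nrm (phi 0).
Proof.
move=> hphi phi0 r0 phiA.
have [g [g0 dg gE]] := logarithm hphi phi0.
have hg : holo g by move=> t; have [] := has_der_diff (dg t).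
have cg : continuous g := holo_continuous hg.
have n0 := nrm_gt0 (phi0 0).
have gA t : nrm t = r -> complex.Re (g t) <= A.
  by move=> /phiA; rewrite gE ler_pM2l// ler_expR.
pose c := 'd phi 0 1 / phi 0.
have cE : c * r%:C = avg (fun t => g (r%:C * cis t) * cis (- t)).
  by rewrite (cauchy_derivative hg (dg 0) r0).
pose G t := g (r%:C * cis t).
have cG : continuous G by exact: continuous_radius.
have nG t : complex.Re (G t) <= A.
  by apply: gA; rewrite nrmM nrm_cis mulr1 nrm_real gtr0_norm.
have cGc : continuous (fun t => G t * cis t).
  by move=> t; apply: cvgM; [exact: cG|exact: continuous_cis].
have cGN : continuous (fun t => G t * cis (- t)).
  by move=> t; apply: cvgM; [exact: cG|exact: continuous_cisN].
(* the mean value property of [z * g z], which vanishes at 0 *)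
have a1 : avg (fun t => G t * cis t) = 0.
  have hzg : holo (fun z : C => z * g z).
    by move=> z; have [] := has_der_diff (has_derM (has_der_id z) (dg z)).
  have := avg_mean (holo_continuous hzg) (fun z _ => hzg z) r0.
  rewrite mul0r => E.
  apply: (mulfI (_ : r%:C != 0)); first by rewrite eq_complex /= eqxx andbT gt_eqF.
  rewrite mulr0 -E -(avgZ _ cGc); congr avg; apply/funext => t; rewrite /G; ring.
have a2 : avg (fun t => (G t)^* * cis (- t)) = 0.
  have -> : (fun t => (G t)^* * cis (- t)) = (fun t => (G t * cis t)^*).
    by apply/funext => t; rewrite rmorphM -cis_conj.
  by rewrite (avg_conj cGc) a1 conjc0.
have cGJ : continuous (fun t => (G t)^* * cis (- t)).
  move=> t; apply: (@cvgM _ _ _ _ (fun t => (G t)^*) (fun t => cis (- t)));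
    last exact: continuous_cisN.
  exact: continuous_conj.
have cAN : continuous (fun t => (2 * A)%:C * cis (- t)).
  by move=> t; apply: cvgMr; exact: continuous_cisN.
have c1 : continuous (fun t => G t * cis (- t) + (G t)^* * cis (- t)).
  by move=> t; apply: cvgD; [exact: cGN|exact: cGJ].
have c2 : continuous (fun t => G t * cis (- t) + (G t)^* * cis (- t) - (2 * A)%:C * cis (- t)).
  exact: (fun t => cvgB (c1 t) (cAN t)).
have c2G : continuous (fun t => 2%:R * G t) by move=> t; apply: cvgMr; exact: cG.
have c2A : continuous (fun _ : R => (2 * A)%:C) by move=> ?; exact: cst_continuous.
have c3 : continuous (fun t => (2 * A)%:C - 2%:R * G t).
  exact: (fun t => cvgB (c2A t) (c2G t)).
have E : c * r%:C = avg (fun t => G t * cis (- t) + (G t)^* * cis (- t) - (2 * A)%:C * cis (- t)).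
  rewrite (avgB c1 cAN) (avgD cGN cGJ) a2 (avgZ _ continuous_cisN) avg_cisN mulr0 subr0 addr0.
  exact: cE.
have E2 : avg (fun t => (2 * A)%:C - 2%:R * G t) = (2 * A)%:C.
  rewrite (avgB c2A c2G) (avgZ _ cG) avg_cst /G.
  by rewrite (avg_mean cg (fun z _ => hg z) r0) g0 mulr0 subr0.
have : nrm (c * r%:C) <= 2 * A.
  have E3 : complex.Re (avg (fun t => (2 * A)%:C - 2%:R * G t)) = 2 * A by rewrite E2.
  rewrite E -[leRHS]E3; apply: (avg_le c2 c3) => t.
  rewrite -mulrDl -mulrBl nrmM nrm_cis mulr1 Re_add_conj -rmorphB nrm_real.
  have -> : complex.Re ((2 * A)%:C - 2%:R * G t) = 2 * A - 2 * complex.Re (G t).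
    have -> : 2%:R * G t = G t + G t by ring.
    by rewrite raddfB raddfD /=; ring.
  by rewrite ler0_norm; have := nG t; lra.
rewrite nrmM nrm_real gtr0_norm// /c nrmM nrmV => H.
rewrite mulrAC ler_pdivlMr// -ler_pdivrMr//; apply: le_trans H.
by rewrite mulrAC.
Qed.

Context {V : normedModType R[i]}.
Implicit Types (f : V -> C) (z w y : V) (r A : R).

Lemma holo_line_diff f z w t : holo f ->
  'd (fun s : C => f (z + s *: w)) t 1 = 'd f (z + t *: w) w.
Proof.
move=> hf; apply: has_der_uniq (diff_has_der (holo_line z w hf t)) _.
exact: has_der_line.
Qed.

Lemma gradient f z w r A : holo f -> (forall y, f y != 0) -> 0 < r ->
  (forall y, nrm (y - z) <= r -> nrm (f y) <= nrm (f z) * expR A) ->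
  nrm ('d f z w) <= 2 * A / r * nrm w * nrm (f z).
Proof.
move=> hf f0 r0 fA; have [->|w0] := eqVneq w 0.
  by rewrite linear0 !nrm0 mulr0 mul0r.
have nw := nrm_gt0 w0.
have := @gradient_C (fun s => f (z + s *: w)) (r / nrm w) A (holo_line z w hf).
rewrite (holo_line_diff z w 0 hf) scale0r addr0 invfM invrK mulrA.
apply => //; first by rewrite divr_gt0.
move=> t tE; apply: fA; rewrite addrC addKr nrmZ tE divfK ?gt_eqF//.
Qed.

Section Harnack.
Variables (f : V -> C) (z w : V) (r A : R).
Hypotheses (hf : holo f) (f0 : forall y, f y != 0) (wr : nrm w < r).
Hypothesis fA : forall y, nrm (y - z) <= r -> nrm (f y) <= expR A.

Let v y := A - ln (nrm (f y)).
Let phi (s : C) := f (z + s *: w).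

Let r0 : 0 < r.
Proof. exact: le_lt_trans (nrm_ge0 w) wr. Qed.

(** The gradient estimate on the ball of radius [r - s * nrm w] around
    [z + s *: w], which lies in the ball of radius [r] around [z]. *)
Lemma ray_bound (s : R) : 0 <= s <= 1 ->
  nrm ('d phi (s%:C : C) (1 : C) / phi s%:C) <= 2 * v (z + s%:C *: w) / (r - s * nrm w) * nrm w.
Proof.
move=> /andP[s0 s1].
have sw : s * nrm w <= nrm w by rewrite ler_piMl ?nrm_ge0.
have d0 : 0 < r - s * nrm w by rewrite subr_gt0 (le_lt_trans sw).
rewrite /phi holo_line_diff// nrmM nrmV ler_pdivrMr ?nrm_gt0//.
apply: gradient => // y yz.
rewrite /v expRB lnK ?posrE ?nrm_gt0// mulrCA divff ?mulr1 ?gt_eqF ?nrm_gt0//.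
apply: fA; rewrite -(subrK (z + s%:C *: w) y) -addrA.
apply: le_trans (nrmD _ _) _.
by rewrite [z + _ - z]addrAC subrr add0r nrmZ nrm_real ger0_norm//; lra.
Qed.

Let hphi : holo phi. Proof. exact: holo_line. Qed.
Let phi0 t : phi t != 0. Proof. exact: f0. Qed.

(** By [ray_bound], [v (z + s *: w) * (r - s * nrm w) ^+ 2] is nonincreasing
    in [s]. *)
Lemma harnack : v (z + w) * (r - nrm w) ^+ 2 <= v z * r ^+ 2.
Proof.
have [g [g0 dg gE]] := logarithm hphi phi0.
have vE (s : C) : v (z + s *: w) = v z - complex.Re (g s).
  rewrite /v -/(phi s) gE lnM ?posrE ?nrm_gt0 ?expR_gt0// expRK /phi scale0r addr0; ring.
pose k := nrm w.
pose G (s : C) := (g s - (v z)%:C) * ((r%:C - s * k%:C) * (r%:C - s * k%:C)).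
pose L (s : C) : C := r%:C - s * k%:C.
have dL s : has_der L s (- k%:C).
  move=> e e0; exists 1 => // h _.
  have -> : L (s + h) - L s - - k%:C * h = 0 by rewrite /L; ring.
  by rewrite nrm0 mulr_ge0 ?nrm_ge0// ltW.
have dgv s : has_der (fun s => g s - (v z)%:C) s ('d phi s 1 / phi s).
  move=> e e0; have [d d0 dP] := dg s e e0; exists d => // h /dP.
  by have -> : g (s + h) - (v z)%:C - (g s - (v z)%:C) = g (s + h) - g s by ring.
have dG s := has_derM (dgv s) (has_derM (dL s) (dL s)).
have ReG (s : R) : complex.Re (G s%:C) = - v (z + s%:C *: w) * (r - s * k) ^+ 2.
  rewrite /G; have -> : (r%:C - s%:C * k%:C) * (r%:C - s%:C * k%:C) = ((r - s * k) ^+ 2)%:C.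
    by rewrite rmorphXn rmorphB rmorphM expr2.
  by rewrite Re_mulr raddfB /= vE; ring.
have := @rder_nondecr _ (fun s => G s%:C) (fun s => 'd phi (s%:C : C) (1 : C) / phi s%:C * (L s%:C * L s%:C) +
   (g s%:C - (v z)%:C) * (- k%:C * L s%:C + L s%:C * - k%:C)) 0 1 ler01.
have -> : complex.Re (G 0%:C) = - (v z * r ^+ 2).
  by rewrite ReG scale0r addr0 mul0r subr0 mulNr.
have -> : complex.Re (G 1%:C) = - (v (z + w) * (r - nrm w) ^+ 2).
  by rewrite ReG scale1r mul1r mulNr.
rewrite lerN2; apply; first by move=> s _; apply: (@has_der_rder _ G); exact: dG.
move=> s s01.
have := ray_bound s01; set c := 'd phi _ 1 / _; set vs := v _ => cb.
move: s01 => /andP[s0 s1].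
have sk : s * k <= k by rewrite ler_piMl ?nrm_ge0.
have d0 : 0 < r - s * k by rewrite subr_gt0 (le_lt_trans sk).
have LE : L s%:C = (r - s * k)%:C by rewrite /L rmorphB rmorphM.
have -> : - k%:C * L s%:C + L s%:C * - k%:C = (- (2 * k * (r - s * k)))%:C.
  by rewrite LE -rmorphN -!rmorphM -rmorphD /=; congr (_%:C); ring.
rewrite LE -rmorphM raddfD /= !Re_mulr raddfB /=.
have -> : complex.Re (g s%:C) - v z = - vs by rewrite /vs vE; ring.
have := absRe_le_nrm c; rewrite ler_norml => /andP[cl _].
have : (- (2 * vs / (r - s * k) * k)) * ((r - s * k) * (r - s * k)) <=
   complex.Re c * ((r - s * k) * (r - s * k)).
  rewrite ler_wpM2r ?mulr_ge0 ?(ltW d0)//; apply: le_trans cl.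
  by rewrite lerN2.
have -> : - (2 * vs / (r - s * k) * k) * ((r - s * k) * (r - s * k)) = - vs * (2 * k * (r - s * k)).
  by field; rewrite gt_eqF.
lra.
Qed.

End Harnack.

(** Integrates the gradient estimate along the segment from [z] to [z + w],
    on which [harnack] bounds [A - ln (nrm (f _))] by four times its value
    at [z]. *)
Lemma ln_nrm_near f z w r A : holo f -> (forall y, f y != 0) -> 0 < r ->
  (forall y, nrm (y - z) <= r -> nrm (f y) <= expR A) -> nrm w <= r / 2 ->
  `|ln (nrm (f (z + w))) - ln (nrm (f z))| <= 16 * (A - ln (nrm (f z))) * nrm w / r.
Proof.
move=> hf f0 r0 fA wr2.
have wr : nrm w < r by lra.
pose phi (s : C) := f (z + s *: w).
have hphi : holo phi by exact: holo_line.
have phi0 t : phi t != 0 by exact: f0.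
have [g [g0 dg gE]] := logarithm hphi phi0.
have := gE 1; rewrite /phi scale1r scale0r addr0 => E.
have -> : ln (nrm (f (z + w))) - ln (nrm (f z)) = complex.Re (g 1).
  by rewrite E lnM ?posrE ?nrm_gt0 ?expR_gt0// expRK; ring.
apply: le_trans (absRe_le_nrm _) _.
set vz := A - _; pose K := 16 * vz * nrm w / r.
have := @mvt_le _ (fun s => g s%:C) (fun s => K%:C * s%:C)
  (fun s => 'd phi (s%:C : C) (1 : C) / phi s%:C) (fun=> K%:C) 0 1 ler01.
rewrite /= !mulr0 mulr1 !subr0 (_ : g 0%:C = 0)// subr0; apply.
- by move=> s _; exact: has_der_rder.
- by move=> s _; exact: rder_id.
move=> s s01; apply: le_trans (ray_bound hf f0 wr fA s01) _.
move: s01 => /andP[s0 s1].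
have k0 := nrm_ge0 w.
have sw : s * nrm w <= nrm w by rewrite ler_piMl.
have d0 : 0 < r - s * nrm w by lra.
have nsw : nrm (s%:C *: w) = s * nrm w by rewrite nrmZ nrm_real ger0_norm.
have swr : nrm (s%:C *: w) < r by rewrite nsw; lra.
have := harnack hf f0 swr fA; rewrite nsw -/vz; set vs := A - _ => H.
have vs0 : 0 <= vs.
  rewrite subr_ge0 -ler_expR lnK ?posrE ?nrm_gt0//; apply: fA.
  by rewrite addrC addKr nsw; lra.
have vs4 : vs <= 4 * vz.
  have : vs * (r / 2) ^+ 2 <= vz * r ^+ 2.
    apply: le_trans H; rewrite ler_wpM2l// ler_sqr ?nnegrE; lra.
  have -> : vs * (r / 2) ^+ 2 = (vs / 4) * r ^+ 2 by field.
  by rewrite ler_pM2r ?exprn_gt0//; lra.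
have -> : K = 16 * vz / r * nrm w by rewrite /K; ring.
rewrite ler_wpM2r//.
rewrite ler_pdivrMr//.
have -> : 16 * vz / r * (r - s * nrm w) = 16 * vz * ((r - s * nrm w) / r) by ring.
have : 2^-1 <= (r - s * nrm w) / r by rewrite ler_pdivlMr//; lra.
have vz0 : 0 <= vz by lra.
move=> h; have : 16 * vz * 2^-1 <= 16 * vz * ((r - s * nrm w) / r).
  by rewrite ler_wpM2l// mulr_ge0.
lra.
Qed.

End ZeroFree.

(** * Tame functions and logarithmic derivatives *)

Section Tame.
Context {R : realType}.
Local Notation C := R[i].
Context {V : normedModType R[i]}.
Implicit Types (f g h phi : V -> C) (z w y : V) (r s : R).

(** When [m] is a growth, one quantity dominates everything that gets lost
    between the radii [r] and [s]: the growth at [s], the radius, and the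
    inverse of the relative gap. *)
Definition scale (m : R -> R) r s := (1 + m s) * s * (s / (s - r)).

(** The small functions with respect to the growth [m]. The second
    radius [s] is left free until the very end, where it is chosen according to
    the behavior of [m]. *)
Definition tame (m : R -> R) z0 g := exists c : R, exists k : nat, 0 <= c /\
  forall r s, 0 <= r -> r < s -> 1 <= s ->
  forall z, nrm (z - z0) <= r -> nrm (g z) <= c * scale m r s ^+ k.

Variables (m : R -> R) (z0 : V).
Hypothesis m_ge0 : forall s, 0 <= m s.

Lemma scale_ge r s : 0 <= r -> r < s -> 1 <= s ->
  [/\ 1 <= scale m r s, m s <= scale m r s, s <= scale m r s & s / (s - r) <= scale m r s].
Proof.
move=> r0 rs s1.
have d0 : 0 < s - r by lra.
have q1 : 1 <= s / (s - r) by rewrite ler_pdivlMr//; lra.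
have ms := m_ge0 s.
have a1 : 1 <= (1 + m s) * s by rewrite -[leLHS]mulr1; apply: ler_pM => //; lra.
have b1 : s <= (1 + m s) * s by rewrite ler_peMl//; lra.
have c1 : m s <= (1 + m s) * s.
  by apply: (@le_trans _ _ (1 + m s)); [lra|rewrite ler_peMr//; lra].
have up x : x <= (1 + m s) * s -> x <= scale m r s.
  by move=> h; apply: le_trans h _; rewrite /scale ler_peMr//; lra.
split; [exact: up|exact: up|exact: up|].
by rewrite /scale ler_peMl//; lra.
Qed.

(** A change of radius may be done in two steps, as halving the gap costs a
    factor 2 only. *)
Lemma scale_mid r s : 0 <= r -> r < s -> scale m ((r + s) / 2) s = 2 * scale m r s.
Proof.
move=> r0 rs; rewrite /scale.
have -> : s - (r + s) / 2 = (s - r) / 2 by field.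
by field; rewrite subr_eq0 gt_eqF.
Qed.

Lemma tame_cst (u : C) : tame m z0 (fun=> u).
Proof.
by exists (nrm u), 0%N; split=> [|*]; [exact: nrm_ge0|rewrite expr0 mulr1].
Qed.

Lemma tameD g h : tame m z0 g -> tame m z0 h -> tame m z0 (fun z => g z + h z).
Proof.
move=> [c [k [c0 gP]]] [d [l [d0 hP]]].
exists (c + d), (k + l)%N; split; first exact: addr_ge0.
move=> r s r0 rs s1 z zr; apply: le_trans (nrmD _ _) _; rewrite mulrDl.
have [X1 _ _ _] := scale_ge r0 rs s1.
apply: lerD.
  apply: le_trans (gP r s r0 rs s1 z zr) _; rewrite ler_wpM2l//.
  by rewrite ler_weXn2l// leq_addr.
apply: le_trans (hP r s r0 rs s1 z zr) _; rewrite ler_wpM2l//.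
by rewrite ler_weXn2l// leq_addl.
Qed.

Lemma tameM g h : tame m z0 g -> tame m z0 h -> tame m z0 (fun z => g z * h z).
Proof.
move=> [c [k [c0 gP]]] [d [l [d0 hP]]].
exists (c * d), (k + l)%N; split; first exact: mulr_ge0.
move=> r s r0 rs s1 z zr; rewrite nrmM exprD mulrACA.
by apply: ler_pM; rewrite ?nrm_ge0//; [exact: gP|exact: hP].
Qed.

Lemma ball_mid r s z y : nrm (z - z0) <= r -> nrm (y - z) <= (s - r) / 2 ->
  nrm (y - z0) <= (r + s) / 2.
Proof.
move=> zr yz; have -> : y - z0 = (y - z) + (z - z0) by rewrite addrA subrK.
by apply: le_trans (nrmD _ _) _; lra.
Qed.

(** Cauchy's estimate on balls of radius [(s - r) / 2]. *)
Lemma tame_diff g w : holo g -> tame m z0 g -> tame m z0 (fun z => 'd g z w).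
Proof.
move=> hg [c [k [c0 gP]]].
exists (c * 2 ^+ k * 2 * nrm w), k.+1; split.
  by rewrite !mulr_ge0 ?exprn_ge0 ?nrm_ge0.
move=> r s r0 rs s1 z zr.
have [X1 _ Xs Xq] := scale_ge r0 rs s1.
have d0 : 0 < (s - r) / 2 by lra.
have := @diff_bound_ball _ _ g z w ((s - r) / 2) (c * (2 * scale m r s) ^+ k) hg d0.
move=> /(_ _)/le_trans; apply.
  move=> y yz; rewrite -scale_mid//; apply: gP => //; [lra|lra|].
  exact: ball_mid yz.
have -> : c * 2 ^+ k * 2 * nrm w * scale m r s ^+ k.+1 =
  c * (2 * scale m r s) ^+ k * (2 * scale m r s) * nrm w.
  by rewrite exprS (exprMn _ 2 (scale m r s)); move: (2 ^+ k) (scale m r s ^+ k) => T Y; ring.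
rewrite ler_wpM2r ?nrm_ge0// ler_wpM2l ?mulr_ge0 ?exprn_ge0//; try lra.
rewrite invf_div ler_wpM2l//; apply: le_trans Xq.
by rewrite ler_peMl// invr_ge0; lra.
Qed.

(** The gradient estimate needs an upper bound for [ln (nrm phi)] relative to
    its value at [z], hence a lower bound for [nrm (phi z)]. As [phi z0] is
    fixed, Harnack's inequality supplies it. *)
Lemma tame_logder phi w (c : R) (k : nat) : holo phi -> (forall y, phi y != 0) -> 0 <= c ->
  (forall r s, 0 <= r -> r < s -> 1 <= s -> forall z, nrm (z - z0) <= r ->
    nrm (phi z) <= nrm (phi z0) * expR (c * scale m r s ^+ k)) ->
  tame m z0 (fun z => 'd phi z w / phi z).
Proof.
move=> hphi phi0 c0 phiP.
exists (2 * c * 2 ^+ k * 8 * nrm w), (k + 3)%N; split.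
  by rewrite !mulr_ge0 ?exprn_ge0 ?nrm_ge0.
move=> r s r0 rs s1 z zr.
have [X1 _ Xs Xq] := scale_ge r0 rs s1.
set X := scale m r s in X1 Xs Xq *.
pose e := (s - r) / 2; have e0 : 0 < e by rewrite /e; lra.
pose r1 := (r + s) / 2.
pose A := c * (2 * X) ^+ k.
have A0 : 0 <= A by rewrite mulr_ge0// exprn_ge0//; lra.
pose A' := A + ln (nrm (phi z0)).
have n0 := nrm_gt0 (phi0 z0).
have expA : expR A' = nrm (phi z0) * expR A by rewrite expRD lnK ?posrE// mulrC.
have bnd y : nrm (y - z0) <= r1 -> nrm (phi y) <= expR A'.
  by move=> yr1; rewrite expA /A -scale_mid//; apply: phiP => //; rewrite /r1; lra.
have zr1 : nrm (z - z0) < r1 by rewrite /r1; lra.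
have := harnack hphi phi0 zr1 bnd; rewrite [z0 + _]addrC subrK.
set v := A' - ln (nrm (phi z)).
have -> : A' - ln (nrm (phi z0)) = A by rewrite /A' addrK.
move=> H.
have v0 : 0 <= v.
  by rewrite subr_ge0 -ler_expR lnK ?posrE ?nrm_gt0//; apply: bnd; rewrite ltW.
have r10 : 0 <= r1 by rewrite /r1; lra.
have qe : r1 / e <= 2 * X.
  have : s / (s - r) * 2 <= X * 2 by rewrite ler_wpM2r.
  have -> : s / (s - r) * 2 = s / e by rewrite /e; field; rewrite subr_eq0 gt_eqF.
  move=> h; rewrite [2 * X]mulrC; apply: le_trans h.
  by rewrite ler_wpM2r ?invr_ge0 ?(ltW e0)// /r1; lra.
have qe1 : e^-1 <= 2 * X.
  have : s / (s - r) * 2 <= X * 2 by rewrite ler_wpM2r.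
  have -> : s / (s - r) * 2 = s * e^-1 by rewrite /e; field; rewrite subr_eq0 gt_eqF.
  move=> h; rewrite [2 * X]mulrC; apply: le_trans h.
  by rewrite ler_peMl// invr_ge0 ltW.
have vA : v <= A * (2 * X) ^+ 2.
  have : v * e ^+ 2 <= A * r1 ^+ 2.
    apply: le_trans H; rewrite ler_wpM2l// ler_sqr ?nnegrE ?subr_ge0; rewrite /e /r1; lra.
  rewrite -ler_pdivlMr ?exprn_gt0// => /le_trans; apply.
  rewrite -mulrA -expr_div_n ler_wpM2l// ler_sqr ?nnegrE//; first by rewrite divr_ge0// ltW.
  lra.
have G : nrm ('d phi z w) <= 2 * v / e * nrm w * nrm (phi z).
  apply: gradient => // y yz.
  rewrite /v expRB lnK ?posrE ?nrm_gt0// mulrCA divff ?mulr1 ?gt_eqF ?nrm_gt0//.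
  by apply: bnd; apply: ball_mid yz.
rewrite nrmM nrmV ler_pdivrMr ?nrm_gt0//; apply: le_trans G _.
rewrite ler_wpM2r ?nrm_ge0//.
have -> : 2 * c * 2 ^+ k * 8 * nrm w * X ^+ (k + 3) = 2 * (A * (2 * X) ^+ 2) * (2 * X) * nrm w.
  by rewrite exprD /A (exprMn _ 2 X); move: (2 ^+ k) (X ^+ k) => T Y; ring.
rewrite ler_wpM2r ?nrm_ge0//; apply: ler_pM => //.
- by rewrite mulr_ge0.
- by rewrite invr_ge0 ltW.
- by rewrite ler_wpM2l.
Qed.

End Tame.

(** * Growth of a zero-free function *)

Section Maximum.
Context {R : realType}.
Local Notation C := R[i].
Context {V : normedModType R[i]}.
Hypothesis cV : compact_balls V.
Implicit Types (z w y : V) (r s : R).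
Variables (f : V -> C) (z0 : V).
Hypotheses (hf : holo f) (f0 : forall y, f y != 0).

(** The radius is truncated at 0 in order that [max_point] be total. *)
Lemma max_point_ex r : exists y, nrm (y - z0) <= Num.max r 0 /\
  forall x, nrm (x - z0) <= Num.max r 0 -> nrm (f x) <= nrm (f y).
Proof.
have r0 : 0 <= Num.max r 0 by rewrite le_max lexx orbT.
by have [y yr ymax] := holo_max z0 cV (holo_continuous hf) r0; exists y.
Qed.

Definition max_point r := projT1 (cid (max_point_ex r)).

(** The maximum of [ln (nrm f)] over the ball, normalized so as to be
    nonnegative. *)
Definition growth r := ln (nrm (f (max_point r))) - ln (nrm (f z0)).

Lemma max_pointP r : 0 <= r -> nrm (max_point r - z0) <= r.
Proof.
move=> r0; rewrite /max_point; case: cid => /= y [+ _].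
by rewrite (max_idPl r0).
Qed.

Lemma growth_ub r y : nrm (y - z0) <= r -> nrm (f y) <= nrm (f z0) * expR (growth r).
Proof.
move=> yr; rewrite /growth expRB !lnK ?posrE ?nrm_gt0//.
rewrite mulrCA divff ?mulr1 ?gt_eqF ?nrm_gt0//.
rewrite /max_point; case: cid => /= x [_]; apply.
by rewrite le_max yr.
Qed.

Lemma growth_ge0 r : 0 <= growth r.
Proof.
rewrite /growth subr_ge0 ler_ln ?posrE ?nrm_gt0// /max_point; case: cid => /= x [_]; apply.
by rewrite subrr nrm0 le_max lexx orbT.
Qed.

Lemma growth_homo r s : 0 <= r -> r <= s -> growth r <= growth s.
Proof.
move=> r0 rs; rewrite /growth lerD2r ler_ln ?posrE ?nrm_gt0//.
have := max_pointP r0 => h.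
have := growth_ub (le_trans h rs); rewrite /growth expRB !lnK ?posrE ?nrm_gt0//.
by rewrite mulrCA divff ?mulr1 ?gt_eqF ?nrm_gt0.
Qed.

Lemma growth_scale r s z : 0 <= r -> r < s -> 1 <= s -> nrm (z - z0) <= r ->
  nrm (f z) <= nrm (f z0) * expR (1 * scale growth r s ^+ 1).
Proof.
move=> r0 rs s1 zr; apply: le_trans (growth_ub zr) _.
rewrite ler_pM2l ?nrm_gt0// ler_expR mul1r expr1.
apply: (le_trans (growth_homo r0 (ltW rs))).
by have [] := scale_ge growth_ge0 r0 rs s1.
Qed.

(** The gradient estimate in large balls: where the derivative is not 0, the
    growth over a ball of radius [r] is at least a multiple of [r]. *)
Lemma growth_linear z w : 'd f z w != 0 ->
  exists2 c : R, 0 < c & exists r1 : R, forall r, r1 <= r -> c * r <= growth r.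
Proof.
move=> d0.
pose a := nrm (z - z0).
have a0 : 0 <= a := nrm_ge0 _.
pose l := ln (nrm (f z)) - ln (nrm (f z0)).
pose D := nrm ('d f z w) / nrm (f z).
have D0 : 0 < D by rewrite divr_gt0 ?nrm_gt0.
have w0 : w != 0 by apply: contra d0 => /eqP ->; rewrite linear0.
have nw := nrm_gt0 w0.
pose c := D / (4 * nrm w).
have c0 : 0 < c by rewrite divr_gt0// mulr_gt0.
have key r : a < r -> 2 * c * (r - a) <= growth r - l.
  move=> ar; have d0' : 0 < r - a by lra.
  have := @gradient _ _ f z w (r - a) (growth r - l) hf f0 d0'.
  move=> /(_ _) H; have {}H : nrm ('d f z w) <= 2 * (growth r - l) / (r - a) * nrm w * nrm (f z).
    apply: H => y yz.
    have yr : nrm (y - z0) <= r.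
      have -> : y - z0 = (y - z) + (z - z0) by rewrite addrA subrK.
      by apply: le_trans (nrmD _ _) _; rewrite /a in yz; lra.
    apply: le_trans (growth_ub yr) _.
    have -> : nrm (f z0) * expR (growth r) = nrm (f z0) * expR l * expR (growth r - l).
      by rewrite -mulrA -expRD [l + _]addrC subrK.
    rewrite ler_wpM2r ?expR_ge0// /l expRB !lnK ?posrE ?nrm_gt0//.
    by rewrite mulrCA divff ?mulr1 ?gt_eqF ?nrm_gt0.
  have DE : D <= 2 * (growth r - l) / (r - a) * nrm w by rewrite ler_pdivrMr ?nrm_gt0.
  have -> : 2 * c * (r - a) = D * ((r - a) / (2 * nrm w)).
    by rewrite /c; field; rewrite gt_eqF.
  have -> : growth r - l = 2 * (growth r - l) / (r - a) * nrm w * ((r - a) / (2 * nrm w)).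
    by field; rewrite !gt_eqF.
  by rewrite ler_wpM2r// divr_ge0 ?mulr_ge0// ltW.
exists c => //.
exists (Num.max (a + 1) ((2 * c * a - l) / c)) => r.
rewrite ge_max => /andP[r1]; rewrite ler_pdivrMr// => r2.
have ar : a < r by lra.
by have := key r ar; lra.
Qed.

End Maximum.

(** * Choice of radii *)

Section GrowthLemma.
Context {R : realType}.
Implicit Types (r s t : R).

(** The radii [r0 * (3 - 2 / 2 ^+ k)] stay below [3 * r0], so [m] cannot
    be multiplied by 4 at every step. At the first step [k] where it is not, [m]
    has grown by a factor [4 ^+ k], whereas [s / (s - r)] is only of the order
    of [2 ^+ k], its square root. *)
Lemma growth_step (m : R -> R) (r0 : R) : 0 < r0 -> 1 <= m r0 ->
  (forall r s, 0 <= r -> r <= s -> m r <= m s) ->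
  exists k : nat, let r := r0 * (3 - 2 * 2^-1 ^+ k) in let s := r0 * (3 - 2 * 2^-1 ^+ k.+1) in
    m s <= 4 * m r /\ 4 ^+ k * m r0 <= m r.
Proof.
move=> r00 m1 mh; pose r k := r0 * (3 - 2 * 2^-1 ^+ k).
have h0 k : 0 < (2^-1 : R) ^+ k by rewrite exprn_gt0.
have h1 k : (2^-1 : R) ^+ k <= 1 by rewrite exprn_ile1//; lra.
have rE : r 0%N = r0 by rewrite /r expr0; ring.
have r3 k : 0 <= r k /\ r k <= 3 * r0.
  have := h0 k; have := h1 k; split; first by rewrite mulr_ge0 ?(ltW r00)//; lra.
  by rewrite /r mulrC ler_pM2r//; lra.
have H : exists k, m (r k.+1) < 4 * m (r k).
  apply: contrapT => /forallNP H.
  have grow k : 4 ^+ k * m r0 <= m (r k).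
    elim: k => [|k ih]; first by rewrite expr0 mul1r rE.
    have /negP := H k; rewrite -leNgt => Hk.
    by apply: le_trans Hk; rewrite exprS -mulrA ler_pM2l.
  pose M := m (3 * r0).
  have kM k : 4 ^+ k <= M.
    have [rk0 rk3] := r3 k.
    apply: le_trans (mh _ _ rk0 rk3); apply: le_trans (grow k).
    by rewrite ler_peMr// exprn_ge0.
  have M0 : 0 <= M by apply: le_trans (kM 0%N); rewrite expr0.
  have := archi_boundP M0; have := kM (Num.bound M).
  have : (Num.bound M)%:R <= 4 ^+ Num.bound M :> R.
    by rewrite -natrX ler_nat ltnW// ltn_expl.
  lra.
exists (ex_minn H); case: ex_minnP => k kP kmin /=; split; first exact: ltW.
suff : forall j, (j <= k)%N -> 4 ^+ j * m r0 <= m (r j) by apply.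
elim=> [|j ih] jk; first by rewrite expr0 mul1r rE.
have : 4 * m (r j) <= m (r j.+1).
  by rewrite leNgt; apply/negP => /kmin; rewrite leqNgt jk.
by apply: le_trans; rewrite exprS -mulrA ler_pM2l// ih// ltnW.
Qed.

(** For the radii chosen in [growth_contra]; [r0] is their order of magnitude,
    and is at most [m r / c] as [m] grows at least linearly. *)
Lemma scale_le (m : R -> R) (c r s r0 : R) : 0 < c -> 1 <= m r -> 0 <= m s ->
  m s <= 4 * m r -> 0 <= s -> s <= 3 * r0 -> r0 <= m r / c ->
  0 <= s / (s - r) -> s / (s - r) <= 3 * m r -> scale m r s <= 45 / c * m r ^+ 3.
Proof.
move=> c0 m1 ms0 ms4 s0 s3 r0m q0 q3.
have -> : 45 / c * m r ^+ 3 = (5 * m r) * (3 * (m r / c)) * (3 * m r).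
  by field; rewrite gt_eqF.
have a0 : 0 <= 1 + m s by lra.
have a1 : 1 + m s <= 5 * m r by lra.
have a2 : s <= 3 * (m r / c) by lra.
apply: (ler_pM _ q0 _ q3); first exact: mulr_ge0.
exact: (ler_pM a0 s0 a1 a2).
Qed.

(** Here [t ^+ 4] is the growth, [q] is [s / (s - r)] and [l] the logarithm of
    the scale: on the right the growth appears to the power 3/4 only. *)
Lemma quartic_le (D E F L t q l : R) : 0 <= D -> 0 <= E -> 0 <= F -> 0 <= L -> 1 <= t ->
  0 <= q -> q <= 3 * t ^+ 2 -> 0 <= l -> l <= L + 12 * t ->
  t ^+ 4 <= q * (D + E * l) + F -> t <= 3 * (D + E * L + 12 * E) + F.
Proof.
move=> D0 E0 F0 L0 t1 q0 q3 l0 lL H.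
have t0 : 0 < t by lra.
have EL : 0 <= E * L by rewrite mulr_ge0.
have A1 : D + E * l <= t * (D + E * L + 12 * E).
  have a1 : E * l <= E * (L + 12 * t) by rewrite ler_wpM2l.
  have a2 : D <= t * D by rewrite ler_peMl.
  have a3 : E * L <= t * (E * L) by rewrite ler_peMl.
  lra.
have A2 : 0 <= D + E * l by rewrite addr_ge0// mulr_ge0.
have A3 : q * (D + E * l) <= 3 * t ^+ 2 * (t * (D + E * L + 12 * E)) by exact: ler_pM.
have A4 : F <= t ^+ 3 * F by rewrite ler_peMl// exprn_ege1.
rewrite -(ler_pM2l (exprn_gt0 3 t0)) -exprSr; apply: le_trans H _.
have -> : t ^+ 3 * (3 * (D + E * L + 12 * E) + F) =
  3 * t ^+ 2 * (t * (D + E * L + 12 * E)) + t ^+ 3 * F by ring.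
exact: lerD.
Qed.

(** For the radii of [growth_step], [s / (s - r)] is at most
    [3 * Num.sqrt (m r)], and by [scale_le] the logarithm of the scale is at
    most a multiple of the fourth root [t] of [m r], up to a constant. The
    assumed inequality then bounds [t] by the constant [G] of [quartic_le],
    which [r0] was chosen to exceed. *)
Lemma growth_contra (m : R -> R) (c r1 D E F : R) :
  (forall r, 0 <= m r) ->
  (forall r s, 0 <= r -> r <= s -> m r <= m s) ->
  0 < c -> (forall r, r1 <= r -> c * r <= m r) ->
  0 <= D -> 0 <= E -> 0 <= F ->
  (forall r s, 0 <= r -> r < s -> 1 <= s -> m s <= 4 * m r ->
     m r <= s / (s - r) * (D + E * ln (scale m r s)) + F) -> False.
Proof.
move=> m0 mh c0 mc D0 E0 F0 mP.
pose L := `|ln (45 / c)|.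
have L0 : 0 <= L by exact: normr_ge0.
pose G := 3 * (D + E * L + 12 * E) + F.
have EL : 0 <= E * L by rewrite mulr_ge0.
have G0 : 0 <= G by rewrite /G; lra.
(* The last term forces [m r0 > G ^+ 4], the others make [r0] large enough for
   the hypotheses. *)
pose r0 := Num.max (Num.max 1 r1) ((G ^+ 4 + 1) / c).
have r01 : 1 <= r0 by rewrite !le_max lexx.
have r0r1 : r1 <= r0 by rewrite !le_max lexx orbT.
have r00 : 0 < r0 by lra.
have mr0c : c * r0 <= m r0 by exact: mc.
have G4 : 0 <= G ^+ 4 by exact: exprn_ge0.
have mr0 : G ^+ 4 + 1 <= m r0.
  apply: le_trans mr0c; rewrite mulrC -ler_pdivrMr//.
  by rewrite le_max lexx orbT.
have mr01 : 1 <= m r0 by lra.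
have [k /=] := growth_step r00 mr01 mh.
pose r := r0 * (3 - 2 * 2^-1 ^+ k); pose s := r0 * (3 - 2 * 2^-1 ^+ k.+1).
rewrite -/r -/s => -[ms mr].
have h0 : 0 < (2^-1 : R) ^+ k by rewrite exprn_gt0.
have h1 : (2^-1 : R) ^+ k <= 1 by rewrite exprn_ile1//; lra.
have hk : (2 : R) ^+ k * 2^-1 ^+ k = 1 by rewrite -exprMn divff// expr1n.
pose T : R := 2 ^+ k.
have T0 : 1 <= T by rewrite /T exprn_ege1//; lra.
have sr : s - r = r0 * 2^-1 ^+ k by rewrite /s /r exprS; field.
have r_ge0 : 0 <= r by rewrite mulr_ge0 ?(ltW r00)//; lra.
have rs : r < s by rewrite -subr_gt0 sr mulr_gt0.
have s1 : 1 <= s.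
  by rewrite /s exprS; apply: (le_trans r01); rewrite ler_peMr ?(ltW r00)//; lra.
have s3 : s <= 3 * r0.
  by rewrite /s exprS mulrC ler_pM2r//; lra.
have q3 : s / (s - r) <= 3 * T.
  rewrite ler_pdivrMr ?subr_gt0// sr.
  have -> : 3 * T * (r0 * 2^-1 ^+ k) = 3 * r0 * (2 ^+ k * 2^-1 ^+ k) by rewrite /T; ring.
  by rewrite hk mulr1.
have {}mr0 : 1 <= m r0 by lra.
have TT : T ^+ 2 <= m r.
  apply: le_trans mr; rewrite /T -exprM mulnC exprM.
  have -> : (2 ^+ 2 : R) = 4 by ring.
  by rewrite ler_peMr// exprn_ge0.
have mr1 : m r0 <= m r.
  by apply: le_trans mr; rewrite ler_peMl// exprn_ege1//; lra.
have m1 : 1 <= m r by lra.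
pose t := Num.sqrt (Num.sqrt (m r)).
have t1 : 1 <= t by rewrite /t -sqrtr1 ler_sqrt// -sqrtr1 ler_sqrt//; lra.
have t0 : 0 <= t by lra.
have t2 : t ^+ 2 = Num.sqrt (m r) by rewrite sqr_sqrtr// sqrtr_ge0.
have t4 : t ^+ 4 = m r by rewrite (exprM t 2 2) t2 sqr_sqrtr.
have Tt : T <= t ^+ 2.
  have E4 : (t ^+ 2) ^+ 2 = m r by rewrite -exprM.
  by rewrite -ler_sqr ?nnegrE ?exprn_ge0// E4.
have Tm : T <= m r by apply: le_trans TT; rewrite expr2 ler_peMr//; lra.
have := mP r s r_ge0 rs s1 ms.
have q0 : 0 <= s / (s - r) by rewrite divr_ge0 ?subr_ge0 ?(ltW rs)//; lra.
have r0m : r0 <= m r / c by rewrite ler_pdivlMr// mulrC; lra.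
have scb : scale m r s <= 45 / c * m r ^+ 3.
  apply: (scale_le c0 m1 (m0 s) ms _ s3 r0m q0).
    exact: le_trans s1.
  by apply: (le_trans q3); rewrite ler_pM2l.
have [sc1 _ _ _] := scale_ge m0 r_ge0 rs s1.
have mr0' : 0 < m r by exact: lt_le_trans m1.
have tp : 0 < t by exact: lt_le_trans t1.
have c45 : 0 < 45 / c by rewrite divr_gt0.
have cm0 : 0 < 45 / c * m r ^+ 3 by exact: mulr_gt0 c45 (exprn_gt0 3 mr0').
have sc0 : 0 < scale m r s by exact: lt_le_trans sc1.
have lnsc : ln (scale m r s) <= L + 12 * t.
  apply: (@le_trans _ _ (ln (45 / c * m r ^+ 3))).
    by rewrite ler_ln ?posrE.
  rewrite lnM ?posrE ?exprn_gt0//.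
  apply: lerD; first exact: ler_norm.
  rewrite -t4 -exprM lnXn// -[leLHS]mulr_natl; apply: ler_wpM2l => //.
  by rewrite -[leRHS]expRK ler_ln ?posrE ?expR_gt0// (le_trans _ (expR_ge1Dx t))// lerDr.
rewrite -t4 => H.
have tG : t <= G.
  apply: (quartic_le D0 E0 F0 L0 t1 q0 _ (ln_ge0 sc1) lnsc H).
  by apply: (le_trans q3); rewrite ler_pM2l.
have : t ^+ 4 <= G ^+ 4 by rewrite lerXn2r ?nnegrE.
have : G ^+ 4 + 1 <= m r.
  by apply: le_trans mr1; apply: le_trans mr0c; rewrite mulrC -ler_pdivrMr// le_max lexx orbT.
rewrite t4; clear; lra.
Qed.

End GrowthLemma.

(** * Products of rotations *)

Section Circle.
Context {R : realType}.
Local Notation C := R[i].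

Lemma nrm_cis_sub1 (a : R) : 0 <= a -> nrm (cis a - 1) <= a.
Proof.
move=> a0.
have iE (s : R) : cexp ('i%C * s%:C) = cis s.
  have -> : 'i%C * s%:C = 0 +i* s :> C.
    by apply/eqP; rewrite eq_complex /=; apply/andP; split; apply/eqP; ring.
  by rewrite /cexp /= expR0 mul1r.
have := @mvt_le _ (fun s => cexp ('i%C * s%:C)) (fun s => 1 * s%:C)
  (fun s => cexp ('i%C * s%:C) * (0 * s%:C + 'i%C * 1)) (fun=> 1) 0 a a0.
rewrite !iE cis0 mul1r mulr0 subr0 /=; apply.
- move=> s _; apply: (@has_der_rder _ (fun z => cexp ('i%C * z))).
  apply: (has_der_comp (has_derM (has_der_cst _ _) (has_der_id _))).
  exact: has_der_cexp.
- by move=> s _; exact: rder_id.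
move=> s _; rewrite iE mul0r add0r mulr1 nrmM nrm_cis mul1r.
by rewrite nrmcE /= expr0n expr1n add0r sqrtr1.
Qed.

Lemma arc_cover (N : nat) (t : R) : (0 < N)%N -> 0 <= t <= pi *+ 2 ->
  exists j : 'I_N, nrm (cis t * cis (- (pi *+ 2 / N%:R *+ j)) - 1) <= pi *+ 2 / N%:R.
Proof.
move=> N0 /andP[t0 t2].
have p0 : 0 < pi *+ 2 :> R by rewrite mulrn_wgt0// pi_gt0.
have N0' : 0 < N%:R :> R by rewrite ltr0n.
pose d : R := pi *+ 2 / N%:R; have d0 : 0 < d by rewrite divr_gt0.
have [tN|tN] := ltP t (pi *+ 2); last first.
  exists (Ordinal N0); rewrite /= mulr0n oppr0 cis0 mulr1.
  have -> : t = pi *+ 2 by apply/eqP; rewrite eq_le t2.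
  by rewrite cis2pi subrr nrm0 ltW.
have td0 : 0 <= t / d by rewrite divr_ge0// ltW.
have /andP[j1 j2] := truncn_itv td0; set j := Num.truncn _ in j1 j2.
have jN : (j < N)%N.
  rewrite -(ltr_nat R); apply: le_lt_trans j1 _.
  by rewrite ltr_pdivrMr// /d mulrC divfK// gt_eqF.
exists (Ordinal jN); rewrite -cisD /= -/d.
rewrite ler_pdivlMr// -mulr_natr in j1.
rewrite ltr_pdivrMr// -natr1 mulrDl mul1r in j2.
have j1' : d *+ j <= t by rewrite -mulr_natl; lra.
apply: le_trans (nrm_cis_sub1 _) _; first by rewrite subr_ge0.
by rewrite -mulr_natl; lra.
Qed.

(** Multiplying [q] with its rotations makes the smallness of [q] near the
    point 1 felt on the whole unit circle, hence at the center. *)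
Lemma rotation_product (q : C -> C) (N : nat) (B b e : R) :
  holo q -> (0 < N)%N -> pi *+ 2 / N%:R <= e -> 0 <= B -> 0 <= b ->
  (forall t : C, nrm t = 1 -> nrm (q t) <= B) ->
  (forall t : C, nrm t = 1 -> nrm (t - 1) <= e -> nrm (q t) <= b * B) ->
  nrm (q 0) ^+ N <= b * B ^+ N.
Proof.
move=> hq N0 Ne B0 b0 qB qb.
pose a (j : nat) : C := cis (- (pi *+ 2 / N%:R *+ j)).
pose p (t : C) := \prod_(j < N) q (t * a j).
have hp : holo p.
  have H (s : seq 'I_N) : holo (fun t : C => \prod_(j <- s) q (t * a j)).
    elim: s => [|j s ih] t.
      have -> : (fun t : C => \prod_(j <- [::] : seq 'I_N) q (t * a j)) = cst 1.
        by apply/funext => u; rewrite big_nil.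
      exact: differentiable_cst.
    have -> : (fun t : C => \prod_(j <- j :: s) q (t * a j)) =
        (fun t : C => q (t * a j) * \prod_(j <- s) q (t * a j)).
      by apply/funext => u; rewrite big_cons.
    have h1 := has_der_comp (has_derM (has_der_id t) (has_der_cst (a j) t)) (diff_has_der (hq (t * a j))).
    by have [] := has_der_diff (has_derM h1 (diff_has_der (ih t))).
  by move=> t; exact: H.
have p0 : p 0 = q 0 ^+ N.
  rewrite /p (eq_bigr (fun=> q 0)); last by move=> j _; rewrite mul0r.
  by rewrite prodr_const card_ord.
have pi0 : 0 < pi *+ 2 :> R by rewrite mulrn_wgt0// pi_gt0.
have nrm_prod (s : seq 'I_N) (F : 'I_N -> C) (P : pred 'I_N) :
    nrm (\prod_(j <- s | P j) F j) = \prod_(j <- s | P j) nrm (F j).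
  by elim/big_rec2: _ => [|j x y _ <-]; rewrite ?nrm1// nrmM.
have bnd (t : R) : 0 <= t <= pi *+ 2 -> nrm (p (1%:C * cis t)) <= b * B ^+ N.
  move=> t02; rewrite mul1r nrm_prod.
  have [j jP] := arc_cover N0 t02.
  have n1 (i : nat) : nrm (cis t * a i) = 1 by rewrite nrmM !nrm_cis mulr1.
  rewrite (bigD1 j)//= -[in leRHS](prednK N0) exprS mulrA.
  apply: ler_pM; rewrite ?nrm_ge0//.
  - by apply: prodr_ge0 => i _; exact: nrm_ge0.
  - by apply: qb => //; exact: le_trans jP Ne.
  have -> : B ^+ N.-1 = \prod_(i < N | i != j) B.
    by rewrite prodr_const cardC1 card_ord.
  by apply: ler_prod => i _; rewrite nrm_ge0/=; exact: qB.
have := mean_value (holo_continuous hp) (fun z _ => hp z) ltr01.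
have cp : continuous (fun t => p (1%:C * cis t)) by apply: continuous_radius;
  exact: holo_continuous.
have := cint_bound (ltW pi0) cp bnd; rewrite subr0 => + E.
by rewrite E p0 nrmM nrm_real ger0_norm ?(ltW pi0)// ler_pM2r// nrmX.
Qed.

End Circle.

Section Counting.
Context {R : realType}.

(** The arcs between consecutive rotations have to fit into the
    neighborhood of [near_max_point], whence 96; the factor 9 comes from
    [2 * pi <= 8] and from rounding up. *)
Lemma rotation_count (r s : R) : 0 <= r -> r < s ->
  exists2 N : nat, (0 < N)%N &
    pi *+ 2 / N%:R <= (s - r) / (96 * s) /\ N%:R <= 9 * (96 * (s / (s - r))).
Proof.
move=> r0 rs; have d0 : 0 < s - r by lra.
have q1 : 1 <= s / (s - r) by rewrite ler_pdivlMr//; lra.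
pose q := 96 * (s / (s - r)); have q1' : 1 <= q by rewrite /q; lra.
have q0 : 0 <= 8 * q by lra.
have /andP[N1 N2] := truncn_itv q0.
exists (Num.truncn (8 * q)).+1 => //; split; last by rewrite -natr1 -/q; lra.
rewrite ler_pdivrMr ?ltr0n//.
have p8 : pi *+ 2 <= 8 :> R by rewrite -mulr_natl; have := pihalf_lt2 R; lra.
apply: (le_trans p8).
have E8 : 8 = (s - r) / (96 * s) * (8 * q).
  by rewrite /q; field; rewrite subr_eq0 !gt_eqF//; lra.
by rewrite [leLHS]E8 ler_wpM2l ?(ltW N2)// divr_ge0//; lra.
Qed.

(** The logarithm of the inequality of [rotation_product], solved
    for [M]. *)
Lemma ln_rotation_bound (a n M B X G : R) (N K : nat) :
  0 < a -> 0 < n -> 1 <= B -> 1 <= X -> N%:R <= G ->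
  a ^+ N <= expR (- (M / 2)) / n * (B * X ^+ K) ^+ N ->
  M <= 2 * (G * (`|ln B| + `|ln a| + K%:R * ln X)) + 2 * `|ln n|.
Proof.
move=> a0 n0 B1 X1 NG H.
have B0 : 0 < B by lra.
have X0 : 0 < X by lra.
have XK : 0 < X ^+ K by exact: exprn_gt0.
have {}H : N%:R * ln a <= - (M / 2) - ln n + N%:R * (ln B + K%:R * ln X).
  rewrite !mulr_natl -!lnXn// -(expRK (- (M / 2))).
  rewrite -(lnM _ XK) ?posrE// -lnXn ?mulr_gt0// -ln_div ?posrE ?expR_gt0//.
  rewrite -lnM ?posrE ?divr_gt0 ?expR_gt0 ?exprn_gt0 ?mulr_gt0//.
  rewrite ler_ln ?posrE//; first exact: exprn_gt0.
  by rewrite mulr_gt0 ?divr_gt0 ?expR_gt0 ?exprn_gt0 ?mulr_gt0.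
have lX : 0 <= ln X by rewrite ln_ge0.
pose S := `|ln B| + `|ln a| + K%:R * ln X.
have S0 : 0 <= S by rewrite !addr_ge0// mulr_ge0.
have SP : ln B + K%:R * ln X - ln a <= S.
  by have := ler_norm (ln B); have := ler_norm (- ln a); rewrite normrN /S; lra.
have NS : N%:R * (ln B + K%:R * ln X - ln a) <= G * S.
  apply: (@le_trans _ _ (N%:R * S)); first by rewrite ler_wpM2l.
  by rewrite ler_wpM2r.
by have := ler_norm (- ln n); rewrite normrN -/S; lra.
Qed.

End Counting.

(** * A nonconstant zero-free function is no quotient of tame functions *)

Section Quotient.
Context {R : realType}.
Local Notation C := R[i].
Context {V : normedModType R[i]}.
Hypothesis cV : compact_balls V.
Implicit Types (z w y : V) (r s : R).
Variables (f : V -> C) (z0 : V).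
Hypotheses (hf : holo f) (f0 : forall y, f y != 0).
Let m := growth cV z0 hf.
Let n0 := nrm (f z0).

(** By [ln_nrm_near] on the ball of radius [s - r] around the maximum
    point, [ln (nrm f)] drops by at most
    [16 * (m s - m r) / 96 <= 16 * 3 * m r / 96 = m r / 2]. *)
Lemma near_max_point r s z : 0 <= r -> r < s -> m s <= 4 * m r ->
  nrm (z - max_point cV z0 hf r) <= (s - r) / 96 ->
  n0 * expR (m r / 2) <= nrm (f z).
Proof.
move=> r0 rs ms4; set y := max_point _ _ _ _ => zy.
have d0 : 0 < s - r by lra.
have yr : nrm (y - z0) <= r by exact: max_pointP.
have n00 : 0 < n0 by exact: nrm_gt0.
have fA x : nrm (x - y) <= s - r -> nrm (f x) <= expR (m s + ln n0).
  move=> xy; rewrite expRD lnK ?posrE// mulrC; apply: growth_ub => //.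
  have -> : x - z0 = (x - y) + (y - z0) by rewrite addrA subrK.
  by apply: le_trans (nrmD _ _) _; lra.
have h2 : nrm (z - y) <= (s - r) / 2 by lra.
have := ln_nrm_near hf f0 d0 fA h2; rewrite [y + _]addrC subrK.
have mE : ln (nrm (f y)) = m r + ln n0 by rewrite /m /growth subrK.
rewrite mE ler_norml => /andP[+ _].
have -> : m s + ln n0 - (m r + ln n0) = m s - m r by ring.
have m0 : 0 <= m r by exact: growth_ge0.
have H : 16 * (m s - m r) * nrm (z - y) / (s - r) <= m r / 2.
  rewrite ler_pdivrMr//.
  have : (m s - m r) * nrm (z - y) <= (3 * m r) * ((s - r) / 96).
    apply: ler_pM; rewrite ?nrm_ge0//; last by lra.
    by rewrite subr_ge0; apply: growth_homo => //; exact: ltW.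
  by lra.
move=> K; rewrite -ler_ln ?posrE ?mulr_gt0 ?expR_gt0 ?nrm_gt0//.
by rewrite lnM ?posrE ?expR_gt0// expRK; lra.
Qed.

(** If [f] were not constant, it would be large near its maximum points, and
    [Q] small there, as [Q * f] is tame. By [rotation_product] on the circle
    around [z0] through a maximum point, [Q z0] would be small, for radii that
    [growth_contra] chooses. *)
Lemma tame_quotient (Q : V -> C) : holo Q -> Q z0 != 0 ->
  tame m z0 Q -> tame m z0 (fun z => Q z * f z) -> forall z w, 'd f z w = 0.
Proof.
move=> hQ Q0 [c1 [k1 [c10 tQ]]] [c2 [k2 [c20 tQf]]] z w.
apply/eqP/negP => /negP d0.
have [c c0 [r1 cP]] := growth_linear cV z0 hf f0 d0.
have m0 r : 0 <= m r by exact: growth_ge0.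
have mh r s : 0 <= r -> r <= s -> m r <= m s by exact: growth_homo.
have n00 : 0 < n0 by exact: nrm_gt0.
pose a := nrm (Q z0); have a0 : 0 < a by exact: nrm_gt0.
pose Bc := c1 + c2 + 1; have Bc0 : 1 <= Bc by rewrite /Bc; lra.
pose K := (k1 + k2)%N.
pose D := 2 * 9 * 96 * (`|ln Bc| + `|ln a|).
pose E := 2 * 9 * 96 * K%:R : R.
have D0 : 0 <= D by rewrite /D mulr_ge0 ?addr_ge0.
have E0 : 0 <= E by rewrite /E mulr_ge0.
have F0 : 0 <= 2 * `|ln n0| by rewrite mulr_ge0.
apply: (growth_contra m0 mh c0 cP D0 E0 F0).
move=> r s r0 rs s1 ms4.
have [X1 _ _ _] := scale_ge m0 r0 rs s1.
set X := scale m r s in X1 *.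
have d0' : 0 < s - r by lra.
pose B := Bc * X ^+ K.
have XK : 1 <= X ^+ K by exact: exprn_ege1.
have B1 : 1 <= B by rewrite /B -[leLHS]mulr1; apply: ler_pM => //; lra.
have XB c' k' : 0 <= c' -> c' <= Bc -> (k' <= K)%N -> c' * X ^+ k' <= B.
  move=> c'0 c'B k'K; apply: ler_pM => //; last by rewrite ler_weXn2l.
  by apply: exprn_ge0; lra.
pose y := max_point cV z0 hf r; pose u := y - z0.
have ur : nrm u <= r by exact: max_pointP.
pose q (t : C) := Q (z0 + t *: u).
have hq : holo q by exact: holo_line.
pose e := (s - r) / (96 * s).
have [N N0 [Ne NG]] := rotation_count r0 rs.
have inball (t : C) : nrm t = 1 -> nrm (z0 + t *: u - z0) <= r.
  by move=> t1; rewrite addrC addKr nrmZ t1 mul1r.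
have qB (t : C) : nrm t = 1 -> nrm (q t) <= B.
  move=> t1; apply: le_trans (tQ r s r0 rs s1 _ (inball t t1)) _.
  by apply: XB => //; [rewrite /Bc; lra|exact: leq_addr].
pose b := expR (- (m r / 2)) / n0.
have b0 : 0 <= b by rewrite divr_ge0 ?expR_ge0// ltW.
have qb (t : C) : nrm t = 1 -> nrm (t - 1) <= e -> nrm (q t) <= b * B.
  move=> t1 te.
  have fl : n0 * expR (m r / 2) <= nrm (f (z0 + t *: u)).
    apply: (near_max_point r0 rs ms4); rewrite -/y.
    have -> : z0 + t *: u - y = (t - 1) *: u.
      have {1}-> : y = z0 + u by rewrite /u addrC subrK.
      by rewrite opprD addrACA subrr add0r scalerBl scale1r.
    rewrite nrmZ; apply: (@le_trans _ _ (e * r)); first by rewrite ler_pM ?nrm_ge0.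
    have -> : (s - r) / 96 = e * s by rewrite /e; field; rewrite gt_eqF//; lra.
    by rewrite ler_wpM2l ?(ltW rs)// /e divr_ge0//; lra.
  have fp : 0 < n0 * expR (m r / 2) by rewrite mulr_gt0 ?expR_gt0.
  have bE : b = (n0 * expR (m r / 2))^-1 by rewrite invfM -expRN mulrC.
  have qf : nrm (q t) * nrm (f (z0 + t *: u)) <= B.
    rewrite -nrmM; apply: le_trans (tQf r s r0 rs s1 _ (inball t t1)) _.
    by apply: XB => //; [rewrite /Bc; lra|exact: leq_addl].
  rewrite bE mulrC ler_pdivlMr//; apply: le_trans qf.
  by rewrite ler_wpM2l ?nrm_ge0.
have B0 : 0 <= B by lra.
have := rotation_product hq N0 Ne B0 b0 qB qb.
rewrite /q scale0r addr0 => H.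
have := ln_rotation_bound a0 n00 Bc0 X1 NG H.
move=> /le_trans; apply; rewrite lerD2r le_eqVlt; apply/orP; left; apply/eqP.
by rewrite /D /E; ring.
Qed.

End Quotient.

(** * Algebra of holomorphic functions *)

Section Holomorphic.
Context {R : realType}.
Local Notation C := R[i].
Context {V : normedModType R[i]}.
Implicit Types (f g h : V -> C) (z w y : V).

Lemma holo_cst (c : C) : holo (fun=> c : C) (V := V).
Proof. by move=> z; exact: (differentiable_cst c z). Qed.

Lemma holoD g h : holo g -> holo h -> holo (fun z => g z + h z).
Proof. by move=> hg hh z; exact: (differentiableD (hg z) (hh z)). Qed.

Lemma holoM g h : holo g -> holo h -> holo (fun z => g z * h z).
Proof. by move=> hg hh z; exact: (differentiableM (hg z) (hh z)). Qed.

Lemma holo_div g h : holo g -> holo h -> (forall y, h y != 0) -> holo (fun z => g z / h z).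
Proof.
move=> hg hh h0; apply: holoM => // z.
exact: (differentiableV (hh z) (h0 z)).
Qed.

Lemma holo_diffM g h z w : holo g -> holo h ->
  'd (fun y => g y * h y) z w = 'd g z w * h z + g z * 'd h z w.
Proof.
move=> hg hh.
have E f : holo f -> has_der (fun s : C => f (z + s *: w)) 0 ('d f z w).
  by move=> hf; have := @has_der_line _ _ f z w 0; rewrite scale0r addr0; apply; exact: hf.
have := has_derM (E _ hg) (E _ hh); rewrite !scale0r !addr0.
exact: has_der_uniq (E _ (holoM hg hh)).
Qed.

Lemma holo_diff_cst (c : C) z w : 'd (fun=> c : C) z w = 0.
Proof.
have := @has_der_line _ _ (fun=> c) z w 0 (holo_cst c _); rewrite scale0r addr0 => H.
exact: has_der_uniq H (has_der_cst _ _).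
Qed.

Lemma holo_diffB g (c : C) z w : holo g -> 'd (fun y => g y - c) z w = 'd g z w.
Proof.
move=> hg.
have E f : holo f -> has_der (fun s : C => f (z + s *: w)) 0 ('d f z w).
  by move=> hf; have := @has_der_line _ _ f z w 0; rewrite scale0r addr0; apply; exact: hf.
have h1 := E _ (holoD hg (holo_cst (- c))).
apply: has_der_uniq h1 _ => e e0; have [d d0 dP] := E _ hg e e0.
exists d => // u ud; have := dP u ud.
by have -> : forall x y : C, x - c - (y - c) = x - y by move=> x y; rewrite opprB addrA subrK.
Qed.

Lemma holo_constant g : holo g -> (forall z w, 'd g z w = 0) -> forall z, g z = g 0.
Proof.
move=> hg dg z.
have H s : has_der (fun s : C => g (0 + s *: z)) s 0.
  by have := @has_der_line _ _ g 0 z s (hg _); rewrite dg.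
by have := has_der_const H 1; rewrite scale0r scale1r !add0r.
Qed.

End Holomorphic.

Section TameHolomorphic.
Context {R : realType}.
Local Notation C := R[i].
Context {V : normedModType R[i]}.
Variables (m : R -> R) (z0 : V).
Hypothesis m_ge0 : forall s, 0 <= m s.
Implicit Types (f g h : V -> C).

(** The algebra of coefficients in which the elimination takes place. *)
Definition tame_holo g := holo g /\ tame m z0 g.

Lemma tame_holo_cst (c : C) : tame_holo (fun=> c).
Proof. by split; [exact: holo_cst|exact: tame_cst]. Qed.

Lemma tame_holoD g h : tame_holo g -> tame_holo h -> tame_holo (fun z => g z + h z).
Proof. by move=> [? ?] [? ?]; split; [exact: holoD|exact: tameD]. Qed.

Lemma tame_holoM g h : tame_holo g -> tame_holo h -> tame_holo (fun z => g z * h z).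
Proof. by move=> [? ?] [? ?]; split; [exact: holoM|exact: tameM]. Qed.

Lemma tame_holoN g : tame_holo g -> tame_holo (fun z => - g z).
Proof.
move=> hg; have := tame_holoM (tame_holo_cst (-1)) hg.
by under [X in tame_holo X]eq_fun do rewrite mulN1r.
Qed.

Lemma tame_holo_diff g w : tame_holo g -> tame_holo (fun z => 'd g z w).
Proof. by move=> [? ?]; split; [exact: holo_diff|exact: tame_diff]. Qed.

Lemma tame_holo_sum (I : Type) (s : seq I) (P : pred I) (F : I -> V -> C) :
  (forall i, P i -> tame_holo (F i)) -> tame_holo (fun z => \sum_(i <- s | P i) F i z).
Proof.
move=> gF; elim: s => [|i s IH].
  by under [X in tame_holo X]eq_fun do rewrite big_nil; exact: tame_holo_cst.
under [X in tame_holo X]eq_fun do rewrite big_cons.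
case Pi: (P i) => //; exact: (tame_holoD (gF i Pi) IH).
Qed.

Lemma tame_holo_prod (I : Type) (s : seq I) (F : I -> V -> C) :
  (forall i, tame_holo (F i)) -> tame_holo (fun z => \prod_(i <- s) F i z).
Proof.
move=> gF; elim: s => [|i s IH].
  by under [X in tame_holo X]eq_fun do rewrite big_nil; exact: tame_holo_cst.
under [X in tame_holo X]eq_fun do rewrite big_cons.
exact: (tame_holoM (gF i) IH).
Qed.

Lemma tame_holo_exp g k : tame_holo g -> tame_holo (fun z => g z ^+ k).
Proof.
move=> hg; elim: k => [|k IH]; first exact: (tame_holo_cst 1).
by under [X in tame_holo X]eq_fun do rewrite exprS; exact: tame_holoM.
Qed.

End TameHolomorphic.

(** * The elimination *)

Section Alternative.
Context {R : realType}.
Local Notation C := R[i].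
Context {V : normedModType R[i]}.
Hypothesis cV : compact_balls V.
Variables (f : V -> C) (hf : holo f) (f0 : forall y, f y != 0).
Implicit Types (P F : V -> C) (z w y : V).
Local Notation gr z0 := (growth cV z0 hf).

Lemma tame_holo_logder z0 w : tame_holo (gr z0) z0 (fun z => 'd f z w / f z).
Proof.
split; first by apply: holo_div => //; exact: holo_diff.
have m0 : forall s, 0 <= gr z0 s by exact: growth_ge0.
apply: (tame_logder m0 w hf f0 (ler01 : 0 <= 1 :> R) (k := 1)).
by move=> r s r0 rs s1 z zr; exact: growth_scale.
Qed.

(** The cofactor is ['d P z w + P z * ('d f z w / f z)]. Iterated, this shows
    that every derivative of [f] is [f] times a tame function. *)
Lemma tame_holo_mul_diff z0 P w : tame_holo (gr z0) z0 P ->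
  exists2 P', tame_holo (gr z0) z0 P' & forall z, 'd (fun y => P y * f y) z w = P' z * f z.
Proof.
move=> gP; exists (fun z => 'd P z w + P z * ('d f z w / f z)).
  apply: tame_holoD; first by move=> s; exact: growth_ge0.
    by apply: tame_holo_diff => // s; exact: growth_ge0.
  exact: (tame_holoM gP (tame_holo_logder z0 w)).
move=> z; apply: (eq_trans (holo_diffM z w (proj1 gP) hf)).
by rewrite mulrDl -mulrA divfK.
Qed.

(** The upper bound that makes [tame_logder] applicable to [P * f - 1]; the
    growth of [f] and the power of the scale that bounds [P] are both absorbed
    into a larger power. *)
Lemma sub1_growth z0 P : tame_holo (gr z0) z0 P -> P z0 * f z0 != 1 ->
  exists c : R, exists k : nat, 0 <= c /\ forall r s, 0 <= r -> r < s -> 1 <= s ->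
    forall z, nrm (z - z0) <= r ->
    nrm (P z * f z - 1) <= nrm (P z0 * f z0 - 1) * expR (c * scale (gr z0) r s ^+ k).
Proof.
move=> [hP [c [k [c0 tP]]]] F1.
set n0 := nrm (f z0); set l := nrm (P z0 * f z0 - 1).
have n00 : 0 <= n0 by exact: nrm_ge0.
have l0 : 0 < l by rewrite nrm_gt0// subr_eq0.
exists (c * n0 + `|ln l| + 2), k.+1; split; first by rewrite !addr_ge0// mulr_ge0.
move=> r s r0 rs s1 z zr.
have [X1 _ _ _] := scale_ge (growth_ge0 cV z0 hf f0) r0 rs s1.
have fz := growth_scale cV hf f0 r0 rs s1 zr.
have Pz := tP r s r0 rs s1 z zr.
set X := scale (gr z0) r s in X1 fz Pz *.
rewrite mul1r expr1 -/n0 in fz.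
have Xk : 1 <= X ^+ k by exact: exprn_ege1.
have XS : X <= X ^+ k.+1 by rewrite exprS ler_peMr//; lra.
have XkS : X ^+ k <= X ^+ k.+1 by rewrite exprS ler_peMl//; lra.
have lE : expR (ln l) = l by rewrite lnK.
apply: (@le_trans _ _ (l * expR (c * n0 - ln l + X ^+ k + X))); last first.
  rewrite ler_wpM2l ?(ltW l0)// ler_expR !mulrDl.
  have h1 : c * n0 <= c * n0 * X ^+ k.+1.
    by rewrite ler_peMr ?mulr_ge0//; lra.
  have h2 : `|ln l| <= `|ln l| * X ^+ k.+1 by rewrite ler_peMr//; lra.
  have h3 : - ln l <= `|ln l| by rewrite -normrN; exact: ler_norm.
  lra.
have -> : c * n0 - ln l + X ^+ k + X = - ln l + (c * n0 + X ^+ k + X) by ring.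
rewrite expRD expRN lE mulrA divff ?gt_eqF// mul1r !expRD.
have e1 : 1 + c * n0 <= expR (c * n0) by exact: expR_ge1Dx.
have e2 : X ^+ k <= expR (X ^+ k).
  by apply: le_trans (expR_ge1Dx _); rewrite ler_wpDl.
have e3 : 1 <= expR X by rewrite -expR0 ler_expR; lra.
apply: (@le_trans _ _ ((1 + c * n0) * X ^+ k * expR X)); last first.
  have cn : 0 <= c * n0 by rewrite mulr_ge0.
  by rewrite ler_wpM2r ?expR_ge0//; apply: ler_pM => //; lra.
apply: le_trans (nrmB _ _) _; rewrite nrm1 nrmM.
have XE : 1 <= X ^+ k * expR X by rewrite -[leLHS]mulr1; apply: ler_pM.
have PF : nrm (P z) * nrm (f z) <= c * X ^+ k * (n0 * expR X).
  by apply: ler_pM; rewrite ?nrm_ge0.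
have -> : (1 + c * n0) * X ^+ k * expR X = c * X ^+ k * (n0 * expR X) + X ^+ k * expR X by ring.
exact: lerD.
Qed.

(** If [dF] does not vanish at [z0], then [psi = dF / (F - 1)] is tame and
    not 0 at [z0]. From [F = P * f] and [dF = P' * f] one gets
    [(P * psi - P') * f = psi], to which [tame_quotient] applies. If [F] is a
    constant other than 0, it applies to [P * f = F]. *)
Lemma zero_or_constant F : holo F -> (forall z, F z != 1) ->
  (forall z0, exists2 P, tame_holo (gr z0) z0 P & F = (fun z => P z * f z)) ->
  (forall z, F z = 0) \/ (forall z w, 'd f z w = 0).
Proof.
move=> hF F1 PF.
have [dF|] := pselect (forall z w, 'd F z w = 0).
  have FE := holo_constant hF dF.
  have [F00|F00] := eqVneq (F 0) 0; first by left=> z; rewrite FE.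
  right; have [P [hP tP] E] := PF 0.
  apply: (@tame_quotient _ _ cV f 0 hf f0 P hP) => //.
    by apply: contra F00 => /eqP P0; rewrite E P0 mul0r.
  have -> : (fun z => P z * f z) = (fun=> F 0) by rewrite -E; apply/funext.
  exact: tame_cst.
move=> /existsNP[z0 /existsNP[w /eqP dF]]; right.
have [P gP E] := PF z0.
have m0 : forall s, 0 <= gr z0 s by exact: growth_ge0.
pose phi z := F z - 1.
have hphi : holo phi by exact: (holoD hF (holo_cst (- 1))).
have phi0 z : phi z != 0 by rewrite subr_eq0.
have [|c [k [c0 cP]]] := sub1_growth gP; first by move: (F1 z0); rewrite E.
have gpsi : tame_holo (gr z0) z0 (fun z => 'd phi z w / phi z).
  split; first by apply: holo_div => //; exact: holo_diff.
  by apply: (tame_logder m0 w hphi phi0 c0 (k := k)); rewrite /phi E.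
have dphi z : 'd phi z w = 'd F z w by exact: holo_diffB.
have [P' gP' EP'] := tame_holo_mul_diff w gP.
pose Q z := P z * ('d phi z w / phi z) - P' z.
have [hQ tQ] : tame_holo (gr z0) z0 Q.
  exact: (tame_holoD m0 (tame_holoM gP gpsi) (tame_holoN gP')).
have QE z : Q z * f z = 'd phi z w / phi z.
  have H : 'd phi z w = P' z * f z by rewrite dphi E EP'.
  have Fz : P z * f z = phi z + 1 by rewrite /phi subrK E.
  rewrite /Q mulrBl -H mulrAC Fz mulrDl mul1r [phi z * _]mulrC divfK//.
  by rewrite addrAC subrr add0r.
apply: (@tame_quotient _ _ cV f z0 hf f0 Q hQ) => //.
  have : Q z0 * f z0 != 0.
    rewrite QE; apply: mulf_neq0; first by rewrite dphi.
    by rewrite invr_eq0; exact: phi0.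
  by rewrite mulf_eq0 negb_or => /andP[].
have -> : (fun z => Q z * f z) = (fun z => 'd phi z w / phi z) by apply/funext.
by case: gpsi.
Qed.

End Alternative.

Section Coordinates.
Context {R : realType} (n : nat).
Local Notation C := R[i].
Local Notation V := 'rV[R[i]]_n.
Variables (m : R -> R) (z0 : V).
Hypothesis m_ge0 : forall s, 0 <= m s.

Lemma tame_holo_coord j : tame_holo m z0 (fun z : V => z 0 j : C).
Proof.
split; first by move=> z; exact: (differentiable_coord z 0 j).
exists (nrm z0 + 1), 1%N; split; first by rewrite addr_ge0 ?nrm_ge0.
move=> r s r0 rs s1 z zr; apply: le_trans (nrm_coord z j) _.
have [_ _ Xs _] := scale_ge m_ge0 r0 rs s1.
have n0 : 0 <= nrm z0 by exact: nrm_ge0.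
rewrite expr1; apply: (@le_trans _ _ ((nrm z0 + 1) * s)); last first.
  by rewrite ler_wpM2l//; lra.
rewrite -(subrK z0 z); apply: le_trans (nrmD _ _) _; nra.
Qed.

Lemma tame_holo_meval (p : mpoly n C) : tame_holo m z0 (fun z : V => meval (fun j => z 0 j) p).
Proof.
under [X in tame_holo _ _ X]eq_fun do rewrite mevalE.
apply: (@tame_holo_sum _ _ m z0 m_ge0 _ (msupp p) xpredT
  (fun i (z : V) => mcoeff i p * \prod_j z 0 j ^+ i j)) => i _.
apply: tame_holoM; first exact: tame_holo_cst.
apply: (@tame_holo_prod _ _ m z0 _ _ (fun j (z : V) => z 0 j ^+ i j)) => j.
by apply: tame_holo_exp; exact: tame_holo_coord.
Qed.

End Coordinates.

(** * Differential operators with polynomial coefficients *)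

Section Operator.
Context {R : realType} (n : nat).
Local Notation C := R[i].
Local Notation V := 'rV[R[i]]_n.
Implicit Types (f : V -> C) (I : multinom n).

Lemma partialE j f : holo f -> partial j f = fun z => 'd f z (delta_mx 0 j).
Proof. by move=> hf; apply/funext => z; rewrite /partial deriveE//; exact: hf. Qed.

Lemma partial_cst j (c : C) : partial j (fun=> c) = (fun=> 0 : C) :> (V -> C).
Proof.
by rewrite partialE; [apply/funext => z; exact: holo_diff_cst|exact: holo_cst].
Qed.

Lemma multi_partial_cst I (c : C) : (1 <= mdeg I)%N -> multi_partial I (fun=> c) = (fun=> 0).
Proof.
move=> I1.
have H j k (b : C) :
    iter k (partial j) (fun=> b) = (fun=> if k == 0%N then b else 0) :> (V -> C).
  by elim: k => //= k ->; rewrite partial_cst.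
have -> : multi_partial I (fun=> c) =
    (fun=> if all (fun j => I j == 0%N) (enum 'I_n) then c else 0) :> (V -> C).
  rewrite /multi_partial; elim: (enum _) => //= j s ->.
  by rewrite H; case: eqP.
case: allP => // I0; move: I1.
rewrite lt0n mdeg_eq0 => /eqP[]; apply/mnmP => j; rewrite mnm0E.
by apply/eqP/I0; rewrite mem_enum.
Qed.

Variables (f : V -> C) (hf : holo f) (f0 : forall y, f y != 0).
Local Notation gr z0 := (growth (@compact_balls_rV R n) z0 hf).

Lemma tame_holo_multi_partial z0 I : exists2 P, tame_holo (gr z0) z0 P &
  multi_partial I f = (fun z => P z * f z).
Proof.
rewrite /multi_partial; elim: (enum _) => [|j s [P gP /= ->]].
  by exists (fun=> 1); [exact: tame_holo_cst|apply/funext => z /=; rewrite mul1r].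
elim: (I j) => [|k [P' gP' /= ->]]; first by exists P.
have [Q gQ QE] := tame_holo_mul_diff f0 (delta_mx 0 j) gP'.
exists Q => //; rewrite partialE; last by apply: holoM => //; case: gP'.
by apply/funext => z; exact: QE.
Qed.

Lemma tame_holo_diffop z0 m (a : multinom n -> mpoly n C) : exists2 P, tame_holo (gr z0) z0 P &
  diffop m a f = (fun z => P z * f z).
Proof.
have m0 : forall s, 0 <= gr z0 s by exact: growth_ge0.
have /choice[P PP] I : exists P, tame_holo (gr z0) z0 P /\ multi_partial I f = (fun z => P z * f z).
  by have [P gP E] := tame_holo_multi_partial z0 I; exists P.
exists (fun z : V => \sum_(I : bmultinom n m.+1 | (1 <= mdeg I)%N)
    meval (fun j => z 0 j) (a I) * P I z).
  apply: (@tame_holo_sum _ _ _ z0 m0 (bmultinom n m.+1) _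
    (fun I : bmultinom n m.+1 => (1 <= mdeg I)%N)
    (fun (I : bmultinom n m.+1) (z : V) => meval (fun j => z 0 j) (a I) * P I z)) => I _.
  by apply: tame_holoM; [exact: tame_holo_meval|case: (PP I)].
apply/funext => z; rewrite /diffop mulr_suml; apply: eq_bigr => I _.
by have [_ ->] := PP I; rewrite mulrA.
Qed.

End Operator.

Theorem corollary4 (R : realType) (n m : nat) (hn : (1 <= n)%N) (hm : (1 <= m)%N)
    (a : multinom n -> mpoly n R[i]) (f : 'rV[R[i]]_n -> R[i]) :
  entire f -> omits f 0 -> omits (diffop m a f) 1 ->
  forall z, diffop m a f z = 0.
Proof.
move=> hf f0' F1.
have f0 z : f z != 0 by apply/eqP; exact: f0'.
have hF : holo (diffop m a f).
  by have [P [hP _] ->] := tame_holo_diffop hf f0 0 m a; exact: holoM.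
have [//||//|df z] := @zero_or_constant R _ (@compact_balls_rV R n) f hf f0 _ hF.
- by move=> z; apply/eqP; exact: F1.
- by move=> z0; exact: tame_holo_diffop.
have -> : f = (fun=> f 0) by apply/funext; exact: holo_constant.
rewrite /diffop big1// => I I1; rewrite multi_partial_cst//.
exact: mulr0.
Qed.
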